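(* Let $n\ge5$ and let $(\mathcal{M}^n,g)=(\mathbb{R}^n,\delta+df\otimes df)$ be the graph of a smooth asymptotically flat function $f:\mathbb{R}^n\to\mathbb{R}$ (of some order $\tau>\frac{n-4}{3}$). Assume that the second Gauss-Bonnet curvature $L_2$ of $g$ is integrable on $(\mathcal{M}^n,g)$. Then the Gauss-Bonnet-Chern mass of $g$ satisfies $$m_2=\frac{c_2(n)}{2}\int_{\mathcal{M}^n}\frac{L_2}{\sqrt{1+|\nabla f|^2}}\,dV_g,$$ where the gradient and norm in $|\nabla f|$ are with respect to the Euclidean metric $\delta$. In particular, if $L_2\ge 0$ then $m_2\ge 0$.
   Context: $\delta$ is the Euclidean metric on $\mathbb{R}^n$. A smooth function $f$ on $\mathbb{R}^n$, with first, second and third partial derivatives $f_i,f_{ij},f_{ijk}$, is called asymptotically flat of order $\tau$ if $f_i(x)=O(|x|^{-\tau/2})$ and $|x||f_{ij}(x)|+|x|^2|f_{ijk}(x)|=O(|x|^{-\tau/2})$ at infinity, for some $\tau>\frac{n-4}{3}$. Curvature conventions (summation convention used): $R_{ijk}^{m}=\partial_i\Gamma^m_{jk}-\partial_j\Gamma^m_{ik}+\Gamma^m_{is}\Gamma^s_{jk}-\Gamma^m_{js}\Gamma^s_{ik}$, $R_{ijkl}=g_{km}R^m_{ijl}$, $R_{ik}=g^{jl}R_{ijkl}$, $R=g^{ik}R_{ik}$; indices are raised with $g$. The second Gauss-Bonnet curvature is $L_2=R_{ijkl}R^{ijkl}-4R_{ij}R^{ij}+R^2$, and $$P^{ijkl}=R^{ijkl}+R^{jk}g^{il}-R^{jl}g^{ik}-R^{ik}g^{jl}+R^{il}g^{jk}+\tfrac12R(g^{ik}g^{jl}-g^{il}g^{jk}).$$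 The Gauss-Bonnet-Chern mass, computed in the standard coordinates of $\mathbb{R}^n$, is $$m_2=c_2(n)\lim_{r\to\infty}\int_{S_r}P^{ijkl}\,\partial_l g_{jk}\,\nu_i\,dS,\qquad c_2(n)=\frac{1}{2(n-1)(n-2)(n-3)\omega_{n-1}},$$ where $S_r$ is the Euclidean coordinate sphere of radius $r$, $\nu$ its Euclidean outward unit normal, $dS$ its Euclidean area element, and $\omega_{n-1}$ the volume of the unit sphere $\mathbb{S}^{n-1}$. $dV_g$ is the volume element of $g$. *)

(* Defs.v *)
From HB Require Import structures.
From mathcomp Require Import all_boot all_order all_algebra.
From mathcomp Require Import all_classical all_reals all_analysis.
From mathcomp Require Import measurable_realfun.

Set Implicit Arguments.
Unset Strict Implicit.
Unset Printing Implicit Defensive.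
Import Order.TTheory GRing.Theory Num.Def Num.Theory.
Import numFieldNormedType.Exports.

Local Open Scope classical_set_scope.
Local Open Scope ring_scope.

Definition rV_display : measure_display. Proof. exact: default_measure_display. Qed.

Section rV_measurable.
Context {R : realType} {n : nat}.

Let coords : 'I_n -> 'rV[R]_n -> measurableTypeR R := fun i v => v 0 i.

Let rV_set0 : g_sigma_preimage coords set0.
Proof. exact: sigma_algebra0. Qed.

Let rV_setC A : g_sigma_preimage coords A -> g_sigma_preimage coords (~` A).
Proof. exact: sigma_algebraC. Qed.

Let rV_bigcup (F : _^nat) : (forall i, g_sigma_preimage coords (F i)) ->
  g_sigma_preimage coords (\bigcup_i (F i)).
Proof. exact: sigma_algebra_bigcup. Qed.

HB.instance Definition _ := @isMeasurable.Build rV_display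
  'rV[R]_n (g_sigma_preimage coords) rV_set0 rV_setC rV_bigcup.

End rV_measurable.


Lemma measurable_coord (R : realType) n (i : 'I_n) :
  measurable_fun setT (fun v : 'rV[R]_n => v 0 i : measurableTypeR R).
Proof.
move=> _ Y mY; rewrite setTI; apply: sub_sigma_algebra => /=.
rewrite -bigcup_seq/=; exists i => /=; first by rewrite mem_index_enum.
by exists Y => //; rewrite setTI.
Qed.

Lemma measurable_fun_rV d (T : measurableType d) (R : realType) n
    (f : T -> 'rV[R]_n) :
  (forall i, measurable_fun setT (fun x => f x 0 i : measurableTypeR R)) ->
  measurable_fun setT f.
Proof.
move=> mf; have : g_sigma_preimage
    (fun i x => f x 0 i : measurableTypeR R) `<=` measurable.
  apply: smallest_sub; first exact: sigma_algebra_measurable.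
  rewrite -bigcup_seq; apply: bigcup_sub => i _ A [B mB <-]; exact: mf.
rewrite (@g_sigma_preimage_comp _ _ n _
  (fun i (v : 'rV[R]_n) => v 0 i : measurableTypeR R) _ f) => h _ A mA.
by apply: h; exists A.
Qed.

Section lebesgue_rV.
Context {R : realType}.

Definition cons_rV n (p : measurableTypeR R * 'rV[R]_n) : 'rV[R]_n.+1 :=
  row_mx (const_mx p.1 : 'rV_1) p.2.

Definition uncons_rV n (v : 'rV[R]_n.+1) : measurableTypeR R * 'rV[R]_n :=
  (v 0 0, \row_j v 0 (lift 0 j)).

Fixpoint lebesgue_rV n : set 'rV[R]_n -> \bar R :=
  match n with
  | 0 => \d_(0 : 'rV[R]_0)
  | n.+1 => pushforward (lebesgue_measure \x @lebesgue_rV n)%E (@cons_rV n)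
  end.

Lemma measurable_cons_rV n : measurable_fun setT (@cons_rV n).
Proof.
apply: measurable_fun_rV => i; case: (split_ordP (i : 'I_(1 + n))) => j ->.
- rewrite (_ : (fun _ => _) = fst); first exact: measurable_fst.
  by apply/funext => p; rewrite /cons_rV (@row_mxEl _ 1 1 n) mxE.
- rewrite (_ : (fun _ => _) = (fun v : 'rV[R]_n => v 0 j) \o snd).
    by apply: measurableT_comp; [exact: measurable_coord|exact: measurable_snd].
  by apply/funext => p; rewrite /cons_rV (@row_mxEr _ 1 1 n).
Qed.

Lemma measurable_uncons_rV n : measurable_fun setT (@uncons_rV n).
Proof.
apply/measurable_fun_pairP; split; first exact: measurable_coord.
apply: measurable_fun_rV => i.
rewrite (_ : (fun _ => _) = fun v : 'rV[R]_n.+1 => v 0 (lift 0 i)).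
  exact: measurable_coord.
by apply/funext => v; rewrite /uncons_rV /= mxE.
Qed.

Lemma cons_rVK n : cancel (@cons_rV n) (@uncons_rV n).
Proof.
case=> a v; congr pair.
  have -> : 0 = lshift n (0 : 'I_1) :> 'I_(1 + n) by exact/val_inj.
  by rewrite /cons_rV (@row_mxEl _ 1 1 n) mxE.
apply/rowP => j; rewrite mxE.
have -> : lift 0 j = rshift 1 j :> 'I_(1 + n) by exact/val_inj.
by rewrite /cons_rV (@row_mxEr _ 1 1 n).
Qed.

Section lebesgue_rVS.
Variables (n : nat) (m : {sigma_finite_measure set 'rV[R]_n -> \bar R}).

Let mS : set 'rV[R]_n.+1 -> \bar R :=
  pushforward (lebesgue_measure \x m)%E (@cons_rV n).

HB.instance Definition _ := Measure.copy mS
  (measure_function_pushforward__canonical__measure_function_Measure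
    (lebesgue_measure \x m)%E (@measurable_cons_rV n)).

Let mS_sigma_finite : sigma_finite setT mS.
Proof.
have /sigma_finiteP[F [TF ndF Foo]] := sigma_finiteT (@lebesgue_measure R).
have /sigma_finiteP[G [TG ndG Goo]] := sigma_finiteT m.
exists (fun k => @uncons_rV n @^-1` (F k `*` G k)).
  rewrite -preimage_bigcup (_ : \bigcup_k _ = setT) ?preimage_setT//.
  apply/seteqP; split => // -[x y] _.
  have [k _ Fkx] : (\bigcup_i F i) x by rewrite -TF.
  have [l _ Gly] : (\bigcup_i G i) y by rewrite -TG.
  exists (maxn k l) => //; split => /=.
    by move: x Fkx; exact/subsetPset/ndF/leq_maxl.
  by move: y Gly; exact/subsetPset/ndG/leq_maxr.
move=> k; have [mF muF] := Foo k; have [mG muG] := Goo k; split.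
  rewrite -[X in measurable X]setTI; apply: measurable_uncons_rV => //.
  exact: measurableX.
rewrite /mS /pushforward -comp_preimage (_ : _ \o _ = id); last first.
  by apply/funext => p /=; rewrite cons_rVK.
rewrite preimage_id product_measure1E//.
by rewrite lte_mul_pinfty// ge0_fin_numE.
Qed.

HB.instance Definition _ :=
  Measure_isSigmaFinite.Build _ _ _ mS mS_sigma_finite.

Lemma lebesgue_rVS : exists m' : {sigma_finite_measure set 'rV[R]_n.+1 -> \bar R},
  pushforward (lebesgue_measure \x m)%E (@cons_rV n) = m' :> (set _ -> _).
Proof. by exists mS. Qed.

End lebesgue_rVS.

Let lebesgue_rV_ex n : exists m : {sigma_finite_measure set 'rV[R]_n -> \bar R},
  @lebesgue_rV n = m :> (set _ -> _).
Proof.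
elim: n => [|n [m mE]] /=; first by eexists.
by rewrite mE; exact: lebesgue_rVS.
Qed.

Variable n : nat.

Let leb0 : @lebesgue_rV n set0 = 0%E.
Proof. by have [m ->] := lebesgue_rV_ex n; exact: measure0. Qed.

Let leb_ge0 A : (0 <= @lebesgue_rV n A)%E.
Proof. by have [m ->] := lebesgue_rV_ex n; exact: measure_ge0. Qed.

Let leb_sigma_additive : semi_sigma_additive (@lebesgue_rV n).
Proof.
by have [m ->] := lebesgue_rV_ex n; exact: measure_semi_sigma_additive.
Qed.

HB.instance Definition _ := isMeasure.Build _ _ _ (@lebesgue_rV n)
  leb0 leb_ge0 leb_sigma_additive.

Let leb_sigma_finite : sigma_finite setT (@lebesgue_rV n).
Proof. by have [m ->] := lebesgue_rV_ex n; exact: sigma_finiteT. Qed.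

HB.instance Definition _ :=
  Measure_isSigmaFinite.Build _ _ _ (@lebesgue_rV n) leb_sigma_finite.

End lebesgue_rV.

Arguments lebesgue_rV R n : clear implicits.

Lemma lebesgue_rV_box (R : realType) n (a b : 'rV[R]_n) :
  (forall i, a 0 i <= b 0 i) ->
  lebesgue_rV R n [set x | forall i, a 0 i <= x 0 i <= b 0 i] = (\prod_i (b 0 i - a 0 i))%:E.
Proof.
elim: n a b => [|n IH] a b ab.
  by rewrite big_ord0 /= diracE mem_set// => -[].
have := IH (\row_i a 0 (lift 0 i)) (\row_i b 0 (lift 0 i)).
rewrite /= /pushforward => H.
set A := _ @^-1` _.
have -> : A = `[a 0 0, b 0 0] `*` [set x : 'rV[R]_n | forall i : 'I_n, (\row_i0 a 0 (lift 0 i0)) 0 i <= x 0 i <= (\row_i0 b 0 (lift 0 i0)) 0 i].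
  have E0 p : cons_rV p 0 (0: 'I_n.+1) = p.1 :> R by have := congr1 fst (cons_rVK p).
  have ES p i : cons_rV p 0 (lift (0: 'I_n.+1) i) = p.2 0 i :> R.
    by have := congr1 snd (cons_rVK p) => /rowP/(_ i); rewrite mxE.
  apply/seteqP; split => p /=.
    move=> h; split; first by have := h 0; rewrite E0 in_itv.
    by move=> i; have := h (lift 0 i); rewrite (ES p i) !mxE.
  move=> [h1 h2] i; case: (unliftP 0 i) => [j ->|->].
    by rewrite (ES p j); have := h2 j; rewrite !mxE.
  by rewrite (E0 p); move: h1; rewrite in_itv.
rewrite product_measure1E//.
- have {}H := H (fun i => ltac:(by rewrite !mxE)).
  rewrite [X in (_ * X)%E = _]H.
  rewrite big_ord_recl EFinM; congr (_ * _)%E.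
    rewrite [LHS]lebesgue_measure_itv/= lte_fin; case: ltP => // h1.
    by have h2 := ab 0; rewrite (_ : a 0 0 = b 0 0) ?subrr//; apply/eqP; rewrite eq_le h1 h2.
  by congr EFin; apply: eq_bigr => i _; rewrite !mxE.
- rewrite (_ : [set x : 'rV[R]_n | _] = \bigcap_(i : 'I_n) (fun x : 'rV[R]_n => x 0 i) @^-1` `[a 0 (lift 0 i), b 0 (lift 0 i)]).
    apply: fin_bigcap_measurable => // i _.
    rewrite -[X in measurable X]setTI; apply: measurable_coord => //.
  apply/seteqP; split => x /= h i; last by have := h i I; rewrite /= !mxE in_itv.
  by move=> _; have := h i; rewrite /= !mxE in_itv.
Qed.

Section euclidean_space.
Context {R : realType} {n : nat}.
Implicit Types (x : 'rV[R]_n) (r : R).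

(* The norm that the library puts on row vectors is the sup norm. *)
Definition enorm x : R := Num.sqrt (\sum_i x 0 i ^+ 2).

Definition sphere r : set 'rV[R]_n := [set x | enorm x = r].

Definition punctured_ball r : set 'rV[R]_n := [set x | 0 < enorm x <= r].

Definition radial_proj r x : 'rV[R]_n := (r / enorm x) *: x.

Lemma measurable_enorm : measurable_fun setT enorm.
Proof.
have -> : enorm = (@powR R ^~ 2^-1) \o (fun x => \sum_i x 0 i ^+ 2).
  apply/funext => x /=; rewrite /enorm powR12_sqrt//.
  by apply: sumr_ge0 => i _; exact: sqr_ge0.
apply: measurableT_comp; first exact: measurable_powR.
apply: measurable_sum => i; apply: measurable_funX; exact: measurable_coord.
Qed.

Lemma measurable_punctured_ball r : measurable (punctured_ball r).
Proof.
rewrite (_ : punctured_ball r = enorm @^-1` `]0, r]).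
  by rewrite -[X in measurable X]setTI; exact: measurable_enorm.
by apply/seteqP; split=> x /=; rewrite in_itv.
Qed.

Lemma measurable_radial_proj r : measurable_fun setT (radial_proj r).
Proof.
apply: measurable_fun_rV => i.
rewrite (_ : (fun _ => _) = (fun x => r * (enorm x) `^ (-1) * x 0 i)).
  apply: measurable_funM; last exact: measurable_coord.
  apply: measurable_funM => //.
  apply: (@measurableT_comp _ _ _ _ _ _ (@powR R ^~ (-1))).
    exact: measurable_powR.
  exact: measurable_enorm.
by apply/funext => x; rewrite mxE powR_inv1// sqrtr_ge0.
Qed.

(* Euclidean area measure of the sphere of radius r > 0 centred at 0: for a   *)
(* Borel set E, it is (n / r) times the Lebesgue measure of the cone with     *)
(* apex 0 (removed) over the part of E on the sphere, that is, of the set of  *)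
(* all t *: y with 0 < t <= 1, y in E and enorm y = r.                        *)
Definition sphere_area r (E : set 'rV[R]_n) : \bar R :=
  ((n%:R / `|r|)%:E
   * lebesgue_rV R n (radial_proj r @^-1` E `&` punctured_ball r))%E.

HB.instance Definition _ r := Measure.copy (sphere_area r)
  (mscale (n%:R / `|r|)%:nng
    (measure_function_pushforward__canonical__measure_function_Measure
      (mrestr (lebesgue_rV R n) (measurable_punctured_ball r))
      (measurable_radial_proj r))).

Definition partial (i : 'I_n) (h : 'rV[R]_n -> R) : 'rV[R]_n -> R :=
  fun x => 'D_(delta_mx 0 i) h x.

Definition smooth (h : 'rV[R]_n -> R) : Prop :=
  forall s : seq 'I_n, let hs := foldr partial h s in
    continuous hs /\ forall i x, derivable hs x (delta_mx 0 i).

Definition grad (h : 'rV[R]_n -> R) x : 'rV[R]_n := \row_i partial i h x.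

(* "O(|x|^(- tau / 2)) at infinity", spelled out *)
Definition asymptotically_flat (tau : R) (f : 'rV[R]_n -> R) : Prop :=
  exists C r0 : R, forall x, r0 <= enorm x ->
    (forall i, `|partial i f x| <= C * enorm x `^ (- tau / 2)) /\
    (forall i j k,
      enorm x * `|partial j (partial i f) x|
      + enorm x ^+ 2 * `|partial k (partial j (partial i f)) x|
      <= C * enorm x `^ (- tau / 2)).

Definition graph_metric (f : 'rV[R]_n -> R) x : 'M[R]_n :=
  \matrix_(i, j) ((i == j)%:R + partial i f x * partial j f x).

End euclidean_space.

Section curvature.
Context {R : realType} {n : nat}.
Variable g : 'rV[R]_n -> 'M[R]_n.
Implicit Types (x : 'rV[R]_n) (i j k l m : 'I_n).

Definition metric_inv x : 'M[R]_n := invmx (g x).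

(* partial_l g_{jk} *)
Definition dmetric l j k x : R := partial l (fun y => g y j k) x.

(* Gamma^m_{jk} *)
Definition christoffel m j k x : R :=
  2^-1 * \sum_s metric_inv x m s *
    (dmetric j s k x + dmetric k s j x - dmetric s j k x).

(* R_{ijk}^m *)
Definition riemann_mixed i j k m x : R :=
  partial i (christoffel m j k) x - partial j (christoffel m i k) x
  + \sum_s (christoffel m i s x * christoffel s j k x
            - christoffel m j s x * christoffel s i k x).

(* R_{ijkl} = g_{km} R_{ijl}^m *)
Definition riemann i j k l x : R :=
  \sum_m g x k m * riemann_mixed i j l m x.

(* R^{ijkl} *)
Definition riemann_up i j k l x : R :=
  \sum_a \sum_b \sum_c \sum_d
    metric_inv x i a * metric_inv x j b * metric_inv x k c * metric_inv x l d
    * riemann a b c d x.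

(* R_{ik} = g^{jl} R_{ijkl} *)
Definition ricci i k x : R :=
  \sum_j \sum_l metric_inv x j l * riemann i j k l x.

(* R^{ik} *)
Definition ricci_up i k x : R :=
  \sum_a \sum_b metric_inv x i a * metric_inv x k b * ricci a b x.

Definition scalar_curvature x : R :=
  \sum_i \sum_k metric_inv x i k * ricci i k x.

Definition gauss_bonnet_L2 x : R :=
  \sum_i \sum_j \sum_k \sum_l riemann i j k l x * riemann_up i j k l x
  - 4 * \sum_i \sum_j ricci i j x * ricci_up i j x
  + scalar_curvature x ^+ 2.

(* P^{ijkl} *)
Definition gauss_bonnet_P i j k l x : R :=
  let h := metric_inv x in
  riemann_up i j k l x
  + ricci_up j k x * h i l - ricci_up j l x * h i k
  - ricci_up i k x * h j l + ricci_up i l x * h j k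
  + 2^-1 * scalar_curvature x * (h i k * h j l - h i l * h j k).

(* integrals against dV_g = sqrt (det g) dx *)
Definition volume_integrable (h : 'rV[R]_n -> R) : Prop :=
  (lebesgue_rV R n).-integrable setT
    (fun x => (h x * Num.sqrt (\det (g x)))%:E).

Definition volume_integral (h : 'rV[R]_n -> R) : R :=
  \int[lebesgue_rV R n]_x (h x * Num.sqrt (\det (g x))).

Definition gbc_flux (r : R) : R :=
  \int[sphere_area r]_(x in sphere r)
    \sum_i \sum_j \sum_k \sum_l
      gauss_bonnet_P i j k l x * dmetric l j k x * (x 0 i / enorm x).

(* (n-1)(n-2)(n-3) is computed in R; sphere_area 1 (sphere 1) is omega_{n-1} *)
Definition gbc_c2 : R :=
  (2 * (n%:R - 1) * (n%:R - 2) * (n%:R - 3)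
   * fine (sphere_area 1 (@sphere R n 1)))^-1.

(* Meaningful only when gbc_flux converges: lim is otherwise unspecified. *)
Definition gbc_mass : R := gbc_c2 * lim (gbc_flux r @[r --> +oo]).

End curvature.

Arguments gbc_c2 R n : clear implicits.

(* Main.v *)
(** Put V = sqrt (1 + |Df|^2) and N = Df / V. By the Gauss equation the
    curvature of g = delta + df (x) df is R_ijkl = h_ik h_jl - h_il h_jk with
    h = D^2 f / V, and g^-1 h is the Jacobian matrix S of N. Hence
    L_2 = 24 sigma_4(S), while the flux density P^{ijkl} d_l g_jk is the vector
    field X = 3 T_3(S) N, where T_3 is the third Newton tensor. The rows of the
    Newton tensors of a Jacobian matrix are divergence free, so
    div X = 3 tr (T_3(S) S) = 12 sigma_4(S) = L_2 / 2 for the Euclidean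
    divergence. As X is smooth on all of R^n, the flux through S_r is exactly
    the integral of L_2 / 2 over the ball B_r; since sqrt (det g) = V >= 1, L_2
    is Lebesgue integrable and dominated convergence concludes.

    The divergence theorem on balls is obtained without polar coordinates. The
    field (r^2 - |x|^2) X vanishes on S_r, so by Fubini and the fundamental
    theorem of calculus on segments its divergence has integral 0 over B_r, i.e.
    the integral of (r^2 - |x|^2) div X over B_r is twice that of a = X . x.
    Subtracting this identity at radii r and c r and letting c tend to 1 from
    the right, the thin shell compares a with the function x |-> a(r x / |x|),
    which is homogeneous of degree 0 and integrates by dilation: it has integral
    (c^n - 1) J over the shell, where J is its integral over B_r. This gives
    r^2 * integral of div X = n J, and (n / r^2) J is the flux of X, because
    the area measure of S_r is defined through cones. *)

Require Import Defs.
From mathcomp Require Import all_boot all_order all_algebra.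
From mathcomp Require Import all_classical all_reals all_analysis.
From mathcomp Require Import measurable_realfun ring lra.
Import Order.TTheory GRing.Theory Num.Def Num.Theory.
Import numFieldNormedType.Exports.

Set Implicit Arguments.
Unset Strict Implicit.
Unset Printing Implicit Defensive.

Local Open Scope classical_set_scope.
Local Open Scope ring_scope.

(** * Smooth functions *)

Section smooth_calculus.
Context {R : realType} {n : nat}.
Implicit Types (u v w : 'rV[R]_n -> R) (i j k : 'I_n) (x y : 'rV[R]_n).
Local Notation "''e_' i" := (delta_mx 0 i : 'rV[R]_n) (at level 8, i at level 2).

Lemma smooth_continuous u : smooth u -> continuous u.
Proof. by move=> /(_ [::])[]. Qed.

Lemma smooth_derivable u i x : smooth u -> derivable u x 'e_i.
Proof. by move=> /(_ [::])[_]; exact. Qed.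

Lemma smooth_partial u i : smooth u -> smooth (partial i u).
Proof. by move=> su s; have := su (rcons s i); rewrite foldr_rcons. Qed.

Lemma smooth_is_derive u i x : smooth u -> is_derive x 'e_i u (partial i u x).
Proof. by move=> su; apply/derivableP/smooth_derivable. Qed.

Lemma partialE u i x (du : R) : is_derive x 'e_i u du -> partial i u x = du.
Proof. by move=> /@derive_val. Qed.

(** Coinduction principle: [smooth] is the largest class of continuous, partially derivable
    functions closed under partial derivatives. It replaces inductions over lists of directions. *)
Lemma smooth_coind (P : ('rV[R]_n -> R) -> Prop) :
  (forall u, P u -> [/\ continuous u, forall i x, derivable u x 'e_i
                      & forall i, P (partial i u)]) ->
  forall u, P u -> smooth u.
Proof.
move=> HP u Pu s.
have : P (foldr partial u s).
  by elim: s => //= i s IH; have [_ _] := HP _ IH; exact.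
by move=> /HP[].
Qed.

Lemma smooth_cst (c : R) : smooth (fun _ : 'rV[R]_n => c).
Proof.
apply: (@smooth_coind (fun u => exists c : R, u = cst c)); last by exists c.
move=> _ [d ->]; split; first exact: cst_continuous.
- by move=> i x; exact: derivable_cst.
- by move=> i; exists 0; apply/funext => x; rewrite /partial derive_cst.
Qed.

Section generated_algebra.
Variable w : 'rV[R]_n -> R.

(** The algebra generated by [w] over the smooth functions. Once the partial derivatives of [w] lie
    in it, the product rule closes it under differentiation and coinduction makes all of it smooth.
    Taking [w] to be 0 yields sums and products; taking it to be 1 / V yields [smooth_tilt]. *)
Inductive smooth_alg : ('rV[R]_n -> R) -> Prop :=
| Alg_smooth u : smooth u -> smooth_alg u
| Alg_gen : smooth_alg w
| Alg_add u v : smooth_alg u -> smooth_alg v -> smooth_alg (u + v)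
| Alg_mul u v : smooth_alg u -> smooth_alg v -> smooth_alg (u * v).

Hypotheses (wc : continuous w) (wd : forall i x, derivable w x 'e_i)
  (wp : forall i, smooth_alg (partial i w)).

Lemma smooth_alg_smooth u : smooth_alg u -> smooth u.
Proof.
move: u; apply: smooth_coind => u; elim=> {u}.
- move=> u su; split; first exact: smooth_continuous.
    by move=> i x; exact: smooth_derivable.
  by move=> i; apply/Alg_smooth/smooth_partial.
- by [].
- move=> u v _ [uc ud up] _ [vc vd vp]; split.
  + by move=> x; apply: continuousD; [exact: uc|exact: vc].
  + by move=> i x; exact: derivableD.
  + move=> i; rewrite (_ : partial i _ = partial i u + partial i v).
      exact: Alg_add.
    by apply/funext => x; rewrite /partial deriveD.
- move=> u v au [uc ud up] av [vc vd vp]; split.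
  + by move=> x; apply: continuousM; [exact: uc|exact: vc].
  + by move=> i x; exact: derivableM.
  + move=> i; rewrite (_ : partial i _ = u * partial i v + v * partial i u).
      by apply: Alg_add; apply: Alg_mul.
    by apply/funext => x; rewrite /partial deriveM.
Qed.

End generated_algebra.

Let alg0 u : smooth_alg (fun=> 0) u -> smooth u.
Proof.
apply: smooth_alg_smooth; first exact: smooth_continuous (@smooth_cst 0).
  by move=> i x; exact: smooth_derivable (@smooth_cst 0).
by move=> i; apply/Alg_smooth/smooth_partial/smooth_cst.
Qed.

Lemma smoothD u v : smooth u -> smooth v -> smooth (fun x => u x + v x).
Proof. by move=> su sv; apply/alg0/Alg_add; exact: Alg_smooth. Qed.

Lemma smoothM u v : smooth u -> smooth v -> smooth (fun x => u x * v x).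
Proof. by move=> su sv; apply/alg0/Alg_mul; exact: Alg_smooth. Qed.

Lemma smoothN u : smooth u -> smooth (fun x => - u x).
Proof.
move=> su; rewrite (_ : (fun _ => _) = (fun x => -1 * u x)).
  by apply: smoothM => //; exact: smooth_cst.
by apply/funext => x; rewrite mulN1r.
Qed.

Lemma smoothB u v : smooth u -> smooth v -> smooth (fun x => u x - v x).
Proof. by move=> su sv; apply: smoothD => //; exact: smoothN. Qed.

Lemma smooth_sum (I : Type) (r : seq I) (P : pred I) (F : I -> 'rV[R]_n -> R) :
  (forall a, smooth (F a)) -> smooth (fun x => \sum_(a <- r | P a) F a x).
Proof.
move=> sF; elim: r => [|a r IH].
  by rewrite (_ : (fun _ => _) = fun=> 0);
    [exact: smooth_cst|apply/funext => x; rewrite big_nil].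
rewrite (_ : (fun _ => _) =
    fun x => (if P a then F a x else 0) + \sum_(a <- r | P a) F a x).
  by apply: smoothD IH; case: (P a); [exact: sF|exact: smooth_cst].
by apply/funext => x; rewrite big_cons; case: (P a) => //; rewrite add0r.
Qed.

Lemma is_derive_coord i k x :
  is_derive x 'e_i (fun y : 'rV[R]_n => y 0 k) ((i == k)%:R : R).
Proof.
rewrite (_ : (i == k)%:R = ('e_i) 0 k); last by rewrite mxE eqxx eq_sym.
set u := fun y : 'rV[R]_n => y 0 k.
have cvgu : h^-1 *: ((u \o shift x) (h *: 'e_i) - u x) @[h --> 0^']
    --> ('e_i) 0 k.
  apply: cvg_near_cst; near=> h; rewrite /u /= !mxE addrK.
  rewrite [LHS]mulrA mulVf ?mul1r//; near: h; exact: nbhs_dnbhs_neq.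
by split; [apply/cvg_ex; exists (('e_i) 0 k)|exact: cvg_lim].
Unshelve. all: by end_near. Qed.

Lemma smooth_coord k : smooth (fun x => x 0 k).
Proof.
(* The coinductive class is the smooth functions with one coordinate adjoined, whose partial
   derivatives are constants. *)
apply: (@smooth_coind
  (fun u => u = (fun x => x 0 k) \/ smooth u)); last by left.
move=> u [->|su]; last first.
  split; first exact: smooth_continuous.
  - by move=> i x; exact: smooth_derivable.
  - by move=> i; right; exact: smooth_partial.
split.
- exact: coord_continuous.
- by move=> i x; have [] := is_derive_coord i k x.
- move=> i; right; rewrite (_ : partial _ _ = fun=> (i == k)%:R).
    exact: smooth_cst.
  by apply/funext => x; exact: partialE (is_derive_coord i k x).
Qed.

(** The difference quotients of the restriction to the line and of [u] along [y] are the same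
    function of the increment. *)
Lemma is_derive_line u x y (t : R) : derivable u (t *: y + x) y ->
  is_derive t 1 (fun s => u (s *: y + x)) ('D_y u (t *: y + x)).
Proof.
have E : (fun h : R => h^-1 *: (((fun s => u (s *: y + x)) \o shift t) (h *: 1)
             - u (t *: y + x)))
    = (fun h => h^-1 *: ((u \o shift (t *: y + x)) (h *: y) - u (t *: y + x))).
  apply/funext => h; rewrite /= [h *: 1]mulr1.
  by rewrite addrA -scalerDl.
by move=> ud; split; rewrite /derivable /derive E.
Qed.

Lemma smooth_line u i x (t : R) : smooth u ->
  is_derive t 1 (fun s => u (s *: 'e_i + x)) (partial i u (t *: 'e_i + x)).
Proof. by move=> su; apply: is_derive_line; exact: smooth_derivable. Qed.

Lemma is_derive1_continuous (F : R -> R) (t d : R) :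
  is_derive t 1 F d -> {for t, continuous F}.
Proof.
by move=> [dF _]; apply: differentiable_continuous; exact/derivable1_diffP.
Qed.

Lemma smooth_MVT u i x (h : R) : 0 < h -> smooth u ->
  exists2 c, 0 < c < h &
    u (h *: 'e_i + x) - u x = h * partial i u (c *: 'e_i + x).
Proof.
move=> h0 su.
have [||c ch E] := @MVT R (fun s => u (s *: 'e_i + x))
  (fun s => partial i u (s *: 'e_i + x)) 0 h h0.
- by move=> t _; exact: smooth_line.
- apply: continuous_subspaceT => t.
  exact: is_derive1_continuous (smooth_line _ _ _ su).
exists c; first by move: ch; rewrite in_itv.
by move: E; rewrite scale0r add0r subr0 mulrC.
Qed.

(* Two applications of the mean value theorem. *)
Let second_difference u i j x (h : R) : 0 < h -> smooth u ->
  exists a b : R, [/\ 0 < a < h, 0 < b < h &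
    u (h *: 'e_i + (h *: 'e_j + x)) - u (h *: 'e_j + x) - (u (h *: 'e_i + x) - u x)
    = h * (h * partial j (partial i u) (b *: 'e_j + (a *: 'e_i + x)))].
Proof.
move=> h0 su.
have [||a ah E] := @MVT R
  (fun s => u (s *: 'e_i + (h *: 'e_j + x)) - u (s *: 'e_i + x))
  (fun s => partial i u (s *: 'e_i + (h *: 'e_j + x))
            - partial i u (s *: 'e_i + x)) 0 h h0.
- by move=> t _; apply: is_deriveB; exact: smooth_line.
- apply: continuous_subspaceT => t; apply: continuousB;
  exact: is_derive1_continuous (smooth_line _ _ _ su).
have [b bh F] := smooth_MVT j (a *: 'e_i + x) h0 (smooth_partial i su).
exists a, b; split => //.
move: E; rewrite !scale0r !add0r subr0 (addrCA (a *: _)) F => E.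
by rewrite [RHS]mulrC -E; ring.
Qed.

(** Schwarz's theorem. The mixed second difference over a square of side h does not change when the
    two directions are exchanged, and it is h^2 times either mixed derivative at some point of the
    square. Continuity at [x] then excludes a gap between the two. *)
Lemma smooth_partialC u i j x : smooth u ->
  partial i (partial j u) x = partial j (partial i u) x.
Proof.
move=> su; apply/eqP/negPn/negP => neq.
pose F := partial i (partial j u); pose G := partial j (partial i u).
have cF : {for x, continuous F}.
  exact/smooth_continuous/smooth_partial/smooth_partial.
have cG : {for x, continuous G}.
  exact/smooth_continuous/smooth_partial/smooth_partial.
(* [e] is half of the supposed gap, so that two errors below [e] cannot bridge it. *)
have [e e0 ee] : exists2 e : R, 0 < e & `|F x - G x| = e + e.
  exists (`|F x - G x| / 2); last exact: splitr.
  by rewrite divr_gt0// normr_gt0 subr_eq0.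
have : \forall y \near x, `|F x - F y| < e /\ `|G x - G y| < e.
  apply: filterI; first by move/cvgr_dist_lt : cF; exact.
  by move/cvgr_dist_lt : cG; exact.
move=> /nbhs_ballP[d /= d0 Hd].
(* In the sup norm a point reached from [x] by two coordinate steps shorter than [h] stays within
   distance [d]. *)
pose h := d / 4.
have h0 : 0 < h by rewrite divr_gt0.
have h_lt : h < d / 2 by rewrite ltr_pM2l// ltf_pV2 ?posrE// ltr_nat.
have near_x a b k l : 0 < a < h -> 0 < b < h ->
    ball x d (b *: 'e_k + (a *: 'e_l + x)).
  move=> /andP[a0 ah] /andP[b0 bh]; rewrite -ball_normE /ball_ /=.
  rewrite addrA opprD addrCA subrr addr0 normrN.
  have e1 m : `|'e_m| <= 1.
    rewrite [leLHS]/normr /= mx_normrE; apply/bigmax_leP; split => // -[p q] _.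
    by rewrite mxE /=; case: (_ && _); rewrite ?normr1 ?normr0.
  rewrite (le_lt_trans (ler_normD _ _))// !normrZ !gtr0_norm//.
  have := ler_wpM2l (ltW a0) (e1 l); have := ler_wpM2l (ltW b0) (e1 k).
  rewrite !mulr1 => H1 H2; apply: (le_lt_trans (lerD H1 H2)).
  by rewrite [ltRHS]splitr; apply: ltrD; apply: lt_trans h_lt.
have [a [b [ah bh E1]]] := second_difference i j x h0 su.
have [a' [b' [ah' bh' E2]]] := second_difference j i x h0 su.
have [_ H1] := Hd _ (near_x _ _ j i ah bh).
have H1' : `|G (b *: 'e_j + (a *: 'e_i + x)) - G x| < e by rewrite distrC.
have [H2 _] := Hd _ (near_x _ _ i j ah' bh').
have FG : F (b' *: 'e_i + (a' *: 'e_j + x)) = G (b *: 'e_j + (a *: 'e_i + x)).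
  have hn0 : h != 0 by rewrite gt_eqF.
  suff : h * (h * F (b' *: 'e_i + (a' *: 'e_j + x)))
      = h * (h * G (b *: 'e_j + (a *: 'e_i + x))).
    by move=> /(mulfI hn0) /(mulfI hn0).
  rewrite -[LHS]E2 -[RHS]E1 (addrCA (h *: 'e_j)).
  by rewrite !opprD addrACA.
rewrite FG in H2; have := le_lt_trans (ler_distD _ _ _) (ltrD H2 H1').
by rewrite -ee ltxx.
Qed.

End smooth_calculus.

(** * Algebra of the Gauss equation *)

Section curvature_algebra.
Context {R : numFieldType} {n : nat}.
Implicit Types (U V X Y q H : 'M[R]_n) (f : 'cV[R]_n) (i j k l : 'I_n).

Lemma conjmxE q X i k :
  (q *m X *m q^T) i k = \sum_a \sum_c q i a * q k c * X a c.
Proof.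
rewrite mxE exchange_big /=; apply: eq_bigr => c _; rewrite !mxE mulr_suml.
by apply: eq_bigr => a _; ring.
Qed.

(** The indices a, c meet only [X] and b, d only [Y], so raising four indices of a product of two
    2-tensors splits into two conjugations. *)
Lemma sum4_conjmx q X Y i j k l :
  \sum_a \sum_b \sum_c \sum_d q i a * q j b * q k c * q l d * (X a c * Y b d)
  = (q *m X *m q^T) i k * (q *m Y *m q^T) j l.
Proof.
rewrite !conjmxE mulr_suml; apply: eq_bigr => a _.
rewrite mulr_sumr; apply: eq_bigr => b _.
rewrite mulr_suml; apply: eq_bigr => c _.
by rewrite mulr_sumr; apply: eq_bigr => d _; ring.
Qed.

Lemma sum_mxtrace X Y : \sum_i \sum_k X i k * Y i k = \tr (X *m Y^T).
Proof.
by apply: eq_bigr => i _; rewrite mxE; apply: eq_bigr => k _; rewrite mxE.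
Qed.

(** This lemma and the next evaluate the two index patterns that arise when P is contracted with the
    derivative of the metric. *)
Lemma contract_ik_jl U V H f i :
  \sum_j \sum_k \sum_l U i k * V j l * (H l j * f k 0)
  = (U *m f) i 0 * \tr (V *m H).
Proof.
rewrite exchange_big /= mxE mulr_suml; apply: eq_bigr => k _.
rewrite /mxtrace mulr_sumr; apply: eq_bigr => j _.
by rewrite mxE mulr_sumr; apply: eq_bigr => l _; ring.
Qed.

Lemma contract_il_jk U V H f i :
  \sum_j \sum_k \sum_l U i l * V j k * (H l j * f k 0)
  = (U *m H *m V *m f) i 0.
Proof.
rewrite exchange_big /= mxE; apply: eq_bigr => k _.
rewrite mxE mulr_suml; apply: eq_bigr => j _.
by rewrite mxE !mulr_suml; apply: eq_bigr => l _; ring.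
Qed.

(** An expression antisymmetric in k and l is contracted with the symmetric [H]. *)
Lemma contract_antisym U V H f i : V^T = V -> H^T = H ->
  \sum_j \sum_k \sum_l (U i k * V j l - U i l * V j k) * (f j 0 * H l k) = 0.
Proof.
move=> sV sH; rewrite big1// => j _.
rewrite (eq_bigr (fun k => \sum_l U i k * V j l * (f j 0 * H l k)
    - \sum_l U i l * V j k * (f j 0 * H l k))); last first.
  by move=> k _; rewrite -sumrB; apply: eq_bigr => l _; ring.
rewrite sumrB [X in X - _]exchange_big /= -sumrB big1// => l _.
rewrite -sumrB big1// => k _.
by rewrite -{2}sH mxE; ring.
Qed.

End curvature_algebra.

(** * Contractions of a curvature tensor of Gauss type *)

Section gauss_equation_algebra.
Context {R : numFieldType} {n : nat}.
Variables (q H : 'M[R]_n).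
Hypotheses (sq : q^T = q) (sH : H^T = H).
Implicit Types (i j k l : 'I_n).

(** [q] stands for the inverse metric and [H] for the second fundamental form, so [S] is the shape
    operator and [s1], ..., [s4] are the power sums of its eigenvalues. Below, [K], [Ric], [Rup] and
    [sc] are [H] with raised indices, the Ricci tensor, its raised form and the scalar curvature. *)
Let S := q *m H.
Let S2 := S *m S.
Let S3 := S *m S2.
Let S4 := S *m S3.
Let s1 := \tr S.
Let s2 := \tr S2.
Let s3 := \tr S3.
Let s4 := \tr S4.

(** The right side of the Gauss equation for a hypersurface of flat space. *)
Definition Riem i j k l : R := H i k * H j l - H i l * H j k.
Let K := q *m H *m q.
Let Ric := s1 *: H - H *m q *m H.
Let Rup := s1 *: K - S2 *m q.
Let sc := s1 ^+ 2 - s2.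

Lemma Riem_up i j k l :
  \sum_a \sum_b \sum_c \sum_d q i a * q j b * q k c * q l d * Riem a b c d
  = K i k * K j l - K i l * K j k.
Proof.
have E := sum4_conjmx q H H; rewrite sq -/K in E.
rewrite -(E i j k l) -(E i j l k) -sumrB; apply: eq_bigr => a _.
rewrite -sumrB; apply: eq_bigr => b _.
rewrite [X in _ - X]exchange_big /= -sumrB; apply: eq_bigr => c _.
by rewrite -sumrB; apply: eq_bigr => d _; rewrite /Riem; ring.
Qed.

Lemma Riem_ricci i k : \sum_j \sum_l q j l * Riem i j k l = Ric i k.
Proof.
have -> : Ric i k = H i k * \tr (q *m H^T) - (H *m q^T *m H) i k.
  by rewrite !mxE sH sq mulrC.
rewrite -sum_mxtrace mulr_sumr mxE -sumrB; apply: eq_bigr => j _.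
rewrite mulr_sumr mxE mulr_suml -sumrB; apply: eq_bigr => l _.
by rewrite mxE /Riem; ring.
Qed.

Lemma Riem_ricci_up i k : \sum_a \sum_b q i a * q k b * Ric a b = Rup i k.
Proof.
by rewrite -conjmxE sq /Ric /Rup /K /S2 /S mulmxBr mulmxBl -scalemxAr -scalemxAl !mulmxA.
Qed.

Lemma Riem_scalar : \sum_i \sum_k q i k * Ric i k = sc.
Proof.
have sRic : Ric^T = Ric.
  by rewrite /Ric linearB linearZ /= !trmx_mul sH sq mulmxA.
by rewrite sum_mxtrace sRic /Ric mulmxBr linearB /= -scalemxAr linearZ /= /sc /s2 /S2 /S !mulmxA.
Qed.

Let trHK (A : 'M[R]_n) : \tr (H *m (A *m q)) = \tr (S *m A).
Proof. by rewrite mulmxA mxtrace_mulC !mulmxA. Qed.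

Let symK : K^T = K.
Proof. by rewrite /K !trmx_mul sH sq mulmxA. Qed.

Let symRup : Rup^T = Rup.
Proof.
by rewrite /Rup linearB linearZ /= symK /S2 /S !trmx_mul sH sq !mulmxA.
Qed.

(** Of the four products in the expansion, the two direct ones give [s2 ^+ 2] each and the two
    crossed ones [s4] each. *)
Lemma Riem_sqnorm :
  \sum_i \sum_j \sum_k \sum_l Riem i j k l * (K i k * K j l - K i l * K j k)
  = 2 * s2 ^+ 2 - 2 * s4.
Proof.
have -> : s2 = \sum_i \sum_k H i k * K i k.
  by rewrite sum_mxtrace symK trHK.
have -> : s4 = \sum_i \sum_j (\sum_k H i k * K j k) * (\sum_l H j l * K i l).
  transitivity (\tr ((H *m K) *m (H *m K))).
    by rewrite /K !mulmxA [RHS]mxtrace_mulC /s4 /S4 /S3 /S2 /S !mulmxA.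
  rewrite /mxtrace; apply: eq_bigr => i _; rewrite mxE; apply: eq_bigr => j _.
  by rewrite !mxE; congr (_ * _); apply: eq_bigr => k _; rewrite -{1}symK mxE.
rewrite expr2 [X in 2 * X]big_distrlr /= !mulr_sumr -sumrB; apply: eq_bigr => i _.
rewrite !mulr_sumr -sumrB; apply: eq_bigr => j _.
rewrite !big_distrlr /= !mulr_sumr.
(* The second double sum is the first with k and l interchanged, so it merely doubles it. *)
transitivity (\sum_k \sum_l (H i k * K i k * (H j l * K j l) -
    H i k * K j k * (H j l * K i l)) + \sum_k \sum_l
    (H i l * K i l * (H j k * K j k) - H i l * K j l * (H j k * K i k))).
  rewrite -big_split; apply: eq_bigr => k _; rewrite -big_split.
  by apply: eq_bigr => l _; rewrite /Riem /=; ring.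
rewrite [X in _ + X]exchange_big -big_split -sumrB; apply: eq_bigr => k _ /=.
rewrite -big_split !mulr_sumr -sumrB; apply: eq_bigr => l _ /=; ring.
Qed.

Lemma Riem_ricci_sqnorm :
  \sum_i \sum_j Ric i j * Rup i j = s1 ^+ 2 * s2 - 2 * s1 * s3 + s4.
Proof.
rewrite sum_mxtrace symRup.
have -> : Ric *m Rup = H *m (s1 ^+ 2 *: S - (2 * s1) *: S2 + S3) *m q.
  rewrite /Ric /Rup /K /S3 /S2 /S !(mulmxBr, mulmxBl, mulmxDr, mulmxDl).
  rewrite -!(scalemxAr, scalemxAl) !scalerA !mulmxA.
  rewrite -expr2 mulr_natl mulr2n scalerDl.
  by rewrite !opprD !opprK !addrA.
rewrite -mulmxA trHK !mulmxDr -scalemxAr.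
by rewrite mulmxN mxtraceD mxtraceD -scalemxAr raddfN /= !mxtraceZ.
Qed.

(** By Newton's identities the right side is 24 sigma_4(S). *)
Lemma Riem_L2 :
  \sum_i \sum_j \sum_k \sum_l Riem i j k l * (K i k * K j l - K i l * K j k)
  - 4 * (\sum_i \sum_j Ric i j * Rup i j) + sc ^+ 2
  = s1 ^+ 4 - 6 * s1 ^+ 2 * s2 + 3 * s2 ^+ 2 + 8 * s1 * s3 - 6 * s4.
Proof. by rewrite Riem_sqnorm Riem_ricci_sqnorm /sc; ring. Qed.

Let P i j k l :=
  K i k * K j l - K i l * K j k
  + Rup j k * q i l - Rup j l * q i k - Rup i k * q j l + Rup i l * q j k
  + 2^-1 * sc * (q i k * q j l - q i l * q j k).

Let e2 := 2^-1 * (s1 ^+ 2 - s2).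
Let e3 := 6^-1 * (s1 ^+ 3 - 3 * s1 * s2 + 2 * s3).

(** For f = Df / tilt and H = tilt D^2 f the second factor is the derivative of the graph metric.
    The matrix on the right is the third Newton tensor of [S], expanded in powers of [S]. *)
Lemma Riem_P_contract (f : 'cV[R]_n) i :
  \sum_j \sum_k \sum_l P i j k l * (H l j * f k 0 + f j 0 * H l k)
  = 3 * ((e3 *: 1%:M - e2 *: S + s1 *: S2 - S3) *m (q *m f)) i 0.
Proof.
have D (A B C : 'I_n -> 'I_n -> 'I_n -> R) :
    (forall j k l, A j k l = B j k l + C j k l) ->
    \sum_j \sum_k \sum_l A j k l
    = \sum_j \sum_k \sum_l B j k l + \sum_j \sum_k \sum_l C j k l.
  move=> E; rewrite -big_split; apply: eq_bigr => j _; rewrite -big_split.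
  apply: eq_bigr => k _; rewrite -big_split; apply: eq_bigr => l _; exact: E.
have sc_sym : (2^-1 * sc *: q)^T = 2^-1 * sc *: q by rewrite linearZ /= sq.
(* [Q1] collects the terms with f_j H_lk, antisymmetrised in k and l; [Q2] and [Q3] are the two
   index patterns paired with H_lj f_k. *)
pose Q1 U V j k l := (U i k * V j l - U i l * V j k) * (f j 0 * H l k) : R.
pose Q2 (U V : 'M[R]_n) j k l := U i k * V j l * (H l j * f k 0) : R.
pose Q3 (U V : 'M[R]_n) j k l := U i l * V j k * (H l j * f k 0) : R.
pose half := 2^-1 * sc *: q.
have -> : \sum_j \sum_k \sum_l P i j k l * (H l j * f k 0 + f j 0 * H l k)
  = \sum_j \sum_k \sum_l Q1 K K j k l - \sum_j \sum_k \sum_l Q1 Rup q j k l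
    - \sum_j \sum_k \sum_l Q1 q Rup j k l + \sum_j \sum_k \sum_l Q1 half q j k l
    + \sum_j \sum_k \sum_l Q2 K K j k l - \sum_j \sum_k \sum_l Q3 K K j k l
    + \sum_j \sum_k \sum_l Q3 q Rup j k l - \sum_j \sum_k \sum_l Q2 q Rup j k l
    - \sum_j \sum_k \sum_l Q2 Rup q j k l + \sum_j \sum_k \sum_l Q3 Rup q j k l
    + \sum_j \sum_k \sum_l Q2 half q j k l - \sum_j \sum_k \sum_l Q3 half q j k l.
  rewrite -!sumrN -!big_split /=; apply: eq_bigr => j _.
  rewrite -!sumrN -!big_split /=; apply: eq_bigr => k _.
  rewrite -!sumrN -!big_split /=; apply: eq_bigr => l _.
  by rewrite /P /Q1 /Q2 /Q3 /half !(mxE _ _ i); ring.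
(* All [Q1] sums vanish; the remaining ones become polynomials in [S] applied to [q *m f]. *)
rewrite !contract_antisym // !contract_ik_jl !contract_il_jk.
set p := q *m f.
have -> : K *m f = S *m p by rewrite /K /p /S !mulmxA.
have -> : K *m H *m K *m f = S3 *m p.
  by rewrite /K /p /S3 /S2 /S !mulmxA.
have RupE : Rup = (s1 *: S - S2) *m q by rewrite mulmxBl -scalemxAl.
have -> : Rup *m f = s1 *: (S *m p) - S2 *m p.
  by rewrite RupE -mulmxA mulmxBl -scalemxAl.
have -> : Rup *m H *m q *m f = s1 *: (S2 *m p) - S3 *m p.
  by rewrite RupE -!mulmxA mulmxBl -scalemxAl /S3 /S2 /p /S !mulmxA.
have -> : q *m H *m Rup *m f = s1 *: (S2 *m p) - S3 *m p.
  rewrite RupE -/S mulmxA -mulmxA mulmxBr -scalemxAr mulmxBl -scalemxAl.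
  by rewrite /S3 /S2.
have -> : half *m H *m q *m f = 2^-1 * sc *: (S *m p).
  by rewrite /half -!scalemxAl -!mulmxA /p /S !mulmxA.
have -> : half *m f = 2^-1 * sc *: p by rewrite -scalemxAl.
have -> : \tr (K *m H) = s2 by rewrite /s2 /K /S2 /S !mulmxA.
have -> : \tr (Rup *m H) = s1 * s2 - s3.
  by rewrite RupE -mulmxA mulmxBl raddfB /= -scalemxAl mxtraceZ
    /s3 /s2 /S3 /S2 /S !mulmxA.
rewrite -/S -/s1 !(mulmxBl, mulmxDl) -!scalemxAl mul1mx.
by rewrite !mxE /sc /e2 /e3; field.
Qed.

End gauss_equation_algebra.

(** * Curvature of a graph *)

Local Opaque partial.

(** * Rules for directional derivatives at a point *)

Section pointwise_derivation_rules.
Context {R : realType} {V : normedModType R}.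
Implicit Types (u v : V -> R) (x y : V).

Lemma is_derive_mul u v x y du dv : is_derive x y u du -> is_derive x y v dv ->
  is_derive x y (fun z => u z * v z) (du * v x + u x * dv).
Proof.
move=> hu hv; apply: is_derive_eq (is_deriveM hu hv) _.
by rewrite /GRing.scale /= addrC mulrC.
Qed.

Lemma is_derive_cstD u (c : R) x y du : is_derive x y u du ->
  is_derive x y (fun z => c + u z) du.
Proof.
move=> hu; have := is_deriveD (is_derive_cst c x y) hu.
by rewrite add0r.
Qed.

Lemma is_derive_cstM u (c : R) x y du : is_derive x y u du ->
  is_derive x y (fun z => c * u z) (c * du).
Proof. exact: is_deriveZ. Qed.

Lemma is_derive_add u v x y du dv : is_derive x y u du -> is_derive x y v dv ->
  is_derive x y (fun z => u z + v z) (du + dv).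
Proof. exact: is_deriveD. Qed.

Lemma is_derive_sub u v x y du dv : is_derive x y u du -> is_derive x y v dv ->
  is_derive x y (fun z => u z - v z) (du - dv).
Proof. exact: is_deriveB. Qed.

Lemma is_derive_bigsum (I : Type) (r : seq I) (F : I -> V -> R) (dF : I -> R) x y :
  (forall i, is_derive x y (F i) (dF i)) ->
  is_derive x y (fun z => \sum_(i <- r) F i z) (\sum_(i <- r) dF i).
Proof.
move=> dFx; elim: r => [|i r IH].
  rewrite big_nil (_ : (fun _ => _) = cst 0); first exact: is_derive_cst.
  by apply/funext => z; rewrite big_nil.
rewrite big_cons (_ : (fun _ => _) = (F i + fun z => \sum_(j <- r) F j z)).
  exact: is_deriveD.
by apply/funext => z; rewrite big_cons.
Qed.

(** Restriction to the line through [x] with direction [y] reduces this to the chain rule in one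
    variable. *)
Lemma is_derive_scalar_comp (F : R -> R) u x y (dF du : R) :
  is_derive (u x) 1 F dF -> is_derive x y u du ->
  is_derive x y (F \o u) (dF * du).
Proof.
move=> hF hu.
have line v dv : is_derive x y v dv <->
    is_derive (0 : R) 1 (fun h : R => v (h *: y + x)) dv.
  have E : 'D_(1 : R) (fun h : R => v (h *: y + x)) 0 = 'D_y v x.
    rewrite /derive; set g1 := fun h => _; set g2 := fun h => _.
    suff -> : g1 = g2 by [].
    by apply/funext => h; rewrite /g1 /g2 /= addr0 scale0r add0r [h *: 1]mulr1.
  split=> -[d e]; split.
  - exact/(derivable1P v x y).
  - by rewrite E.
  - exact/(derivable1P v x y).
  - by rewrite -E.
move/line : hu => hu; apply/line; apply: (is_derive1_comp (g := fun h => u _)).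
by rewrite scale0r add0r.
Qed.

Lemma is_derive_sqrt u x y du : is_derive x y u du -> 0 < u x ->
  is_derive x y (fun z => Num.sqrt (u z)) ((2 * Num.sqrt (u x))^-1 * du).
Proof. by move=> hu /is_derive1_sqrt h; exact: is_derive_scalar_comp h hu. Qed.

Lemma is_derive_inv u x y du : is_derive x y u du -> u x != 0 ->
  is_derive x y (fun z => (u z)^-1) (- (u x) ^- 2 * du).
Proof.
move=> [d e] u0; split; first exact: derivableV.
by rewrite deriveV// e.
Qed.

End pointwise_derivation_rules.

(** * Pointwise algebra of the curvature of a graph *)

Section riemann_algebra.
Context {R : comPzRingType} {n : nat}.
Variables (u : 'I_n -> R) (h : 'I_n -> 'I_n -> R) (t : R).
Implicit Types i j k l m : 'I_n.
(** [u], [h] and [t] stand for the gradient, the Hessian and 1 / V at a point, and [c i] for half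
    the i-th derivative of |Df|^2. *)
Let c i := \sum_s u s * h i s.

Let sum_lin (a b : R) (v w : 'I_n -> R) :
  \sum_s (a * v s - b * w s) = a * (\sum_s v s) - b * \sum_s w s.
Proof. by rewrite sumrB !mulr_sumr. Qed.

(** The terms before the sum are the derivatives of the Christoffel symbols t^2 u_m h_jk and t^2 u_m
    h_ik; the third derivative [d] of f is common to both and cancels. *)
Lemma mixed_riemann_algebra i j k m (d : R) :
  - 2 * t ^+ 4 * c i * u m * h j k + t ^+ 2 * h i m * h j k + t ^+ 2 * u m * d
  - (- 2 * t ^+ 4 * c j * u m * h i k + t ^+ 2 * h j m * h i k
     + t ^+ 2 * u m * d)
  + \sum_s (t ^+ 2 * u m * h i s * (t ^+ 2 * u s * h j k)
             - t ^+ 2 * u m * h j s * (t ^+ 2 * u s * h i k))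
  = t ^+ 2 * (h i m * h j k - h j m * h i k)
    - t ^+ 4 * u m * (c i * h j k - c j * h i k).
Proof.
rewrite (eq_bigr (fun s => t ^+ 4 * u m * h j k * (u s * h i s)
    - t ^+ 4 * u m * h i k * (u s * h j s))); last by move=> s _; ring.
by rewrite sum_lin -/(c i) -/(c j); ring.
Qed.

(** After lowering the index, all terms containing [u k] combine into a multiple of 1 - t^2 (1 +
    |u|^2), which the hypothesis annihilates. *)
Lemma lower_riemann_algebra i j k l :
  t ^+ 2 * (1 + \sum_s u s ^+ 2) = 1 ->
  \sum_m ((k == m)%:R + u k * u m) *
    (t ^+ 2 * (h i m * h j l - h j m * h i l)
     - t ^+ 4 * u m * (c i * h j l - c j * h i l))
  = t * h i k * (t * h j l) - t * h i l * (t * h j k).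
Proof.
set s2 := \sum_s _ => ts.
rewrite (eq_bigr (fun m => (k == m)%:R * (t ^+ 2 * (h i m * h j l - h j m * h i l)
     - t ^+ 4 * u m * (c i * h j l - c j * h i l))
  + (u k * t ^+ 2 * h j l * (u m * h i m) - u k * t ^+ 2 * h i l * (u m * h j m)
    - u k * t ^+ 4 * (c i * h j l - c j * h i l) * u m ^+ 2))); last first.
  by move=> m _; ring.
rewrite big_split sumrB sum_lin -mulr_sumr -/(c i) -/(c j) -/s2 /=.
rewrite (bigD1 k)//= eqxx mul1r big1 ?addr0; last first.
  by move=> m /negbTE; rewrite eq_sym => ->; rewrite mul0r.
transitivity (t ^+ 2 * (h i k * h j l - h j k * h i l)
  + u k * t ^+ 2 * (c i * h j l - c j * h i l) * (1 - t ^+ 2 * (1 + s2))).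
  by ring.
by rewrite ts; ring.
Qed.

End riemann_algebra.

(** * Metric, connection and curvature of the graph of f *)

Section graph_geometry.
Context {R : realType} {n : nat}.
Variable f : 'rV[R]_n -> R.
Hypothesis sf : smooth f.
Implicit Types (i j k l m s : 'I_n) (x : 'rV[R]_n).
Local Notation "''e_' i" := (delta_mx 0 i : 'rV[R]_n) (at level 8, i at level 2).
Local Notation f_ := (fun i => partial i f).
Local Notation B_ := (fun i j => partial i (partial j f)).
Local Notation g := (graph_metric f).

Definition slope2 x : R := \sum_s partial s f x ^+ 2.

(** This is 1 / V, the cosine of the angle between the graph's upward normal and the vertical. *)
Definition tilt x : R := (Num.sqrt (1 + slope2 x))^-1.

Definition normal i x : R := tilt x * partial i f x.

(** Introduced as the Jacobian matrix of N = Df / V, the form that makes the rows of its Newton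
    tensors divergence free; [shapeE] identifies it with the shape operator. *)
Definition shape x : 'M[R]_n := \matrix_(m, i) partial i (normal m) x.

Definition hess x : 'M[R]_n := \matrix_(i, j) partial i (partial j f) x.

Let gc x : 'cV[R]_n := (grad f x)^T.

Lemma slope2_ge0 x : 0 <= slope2 x.
Proof. by apply: sumr_ge0 => s _; exact: sqr_ge0. Qed.

Lemma slope2D1_gt0 x : 0 < 1 + slope2 x.
Proof. by rewrite ltr_wpDr// slope2_ge0. Qed.

Lemma tilt_gt0 x : 0 < tilt x.
Proof. by rewrite invr_gt0 sqrtr_gt0 slope2D1_gt0. Qed.

Lemma tilt_sqr x : tilt x ^+ 2 * (1 + slope2 x) = 1.
Proof.
by rewrite exprVn sqr_sqrtr ?ltW ?slope2D1_gt0// mulVf// gt_eqF ?slope2D1_gt0.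
Qed.

Lemma enorm_grad x : enorm (grad f x) ^+ 2 = slope2 x.
Proof.
rewrite sqr_sqrtr; first by apply: eq_bigr => s _; rewrite mxE.
by apply: sumr_ge0 => s _; exact: sqr_ge0.
Qed.

Let d1 i s x : is_derive x 'e_i (f_ s) (B_ i s x).
Proof. by apply: smooth_is_derive; exact: smooth_partial. Qed.

Let d2 i j s x : is_derive x 'e_i (B_ j s) (partial i (B_ j s) x).
Proof. by apply: smooth_is_derive; do 2 apply: smooth_partial. Qed.

Let BC i j x : B_ i j x = B_ j i x.
Proof. exact: smooth_partialC. Qed.

Lemma is_derive_slope2 i x :
  is_derive x 'e_i slope2 (2 * \sum_s f_ s x * B_ i s x).
Proof.
rewrite mulr_sumr; apply: is_derive_bigsum => s.
by apply: is_derive_eq (is_derive_mul (d1 i s x) (d1 i s x)) _; ring.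
Qed.

Lemma is_derive_tilt i x :
  is_derive x 'e_i tilt (- tilt x ^+ 3 * \sum_s f_ s x * B_ i s x).
Proof.
have q0 := slope2D1_gt0 x.
have dq : is_derive x 'e_i (fun y => 1 + slope2 y)
    (2 * \sum_s f_ s x * B_ i s x).
  exact/is_derive_cstD/is_derive_slope2.
have r0 : Num.sqrt (1 + slope2 x) != 0 by rewrite gt_eqF// sqrtr_gt0.
have dt : is_derive x 'e_i tilt _ := is_derive_inv (is_derive_sqrt dq q0) r0.
apply: (is_derive_eq dt).
by rewrite /tilt; field.
Qed.

(** Each partial derivative of [tilt] is its cube times a smooth function, so the algebra it
    generates over the smooth functions is closed under differentiation. *)
Lemma smooth_tilt : smooth tilt.
Proof.
apply: (@smooth_alg_smooth _ _ tilt); last exact: Alg_gen.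
- move=> x; apply: (@continuous_comp _ _ _ slope2 (fun z => (Num.sqrt (1 + z))^-1)).
    have : smooth slope2.
      by apply: smooth_sum => s; apply: smoothM; exact: smooth_partial.
    by move/smooth_continuous; exact.
  have r0 : Num.sqrt (1 + slope2 x) != 0.
    by rewrite gt_eqF// sqrtr_gt0 slope2D1_gt0.
  have d1z := is_derive_cstD 1 (is_derive_id (slope2 x) 1).
  exact: is_derive1_continuous
    (is_derive_inv (is_derive_sqrt d1z (slope2D1_gt0 x)) r0).
- by move=> i x; have [] := is_derive_tilt i x.
- move=> i; pose c x := - \sum_s f_ s x * B_ i s x.
  rewrite (_ : partial i tilt = tilt * (tilt * (tilt * c))).
    do 3 (apply: Alg_mul; first exact: Alg_gen).
    apply: Alg_smooth; apply/smoothN/smooth_sum => s.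
    by apply: smoothM; do ?apply: smooth_partial.
  by apply/funext => x; rewrite (partialE (is_derive_tilt i x)) /c !fctE; ring.
Qed.

Lemma smooth_normal i : smooth (normal i).
Proof. by apply: smoothM; [exact: smooth_tilt|exact: smooth_partial]. Qed.

Let fsqE x : ((gc x)^T *m gc x) = (slope2 x)%:M.
Proof.
apply/matrixP => a b; rewrite !ord1 !mxE eqxx mulr1n.
by apply: eq_bigr => s _; rewrite !mxE expr2.
Qed.

Let gE x : g x = 1%:M + gc x *m (gc x)^T.
Proof. by apply/matrixP => i j; rewrite !mxE big_ord1 !mxE. Qed.

(** The Sherman-Morrison formula for a rank one perturbation of the identity. *)
Lemma graph_metric_inv x :
  metric_inv g x = 1%:M - tilt x ^+ 2 *: (gc x *m (gc x)^T).
Proof.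
have ts : tilt x ^+ 2 * slope2 x = 1 - tilt x ^+ 2.
  by rewrite -[X in X - _](tilt_sqr x); ring.
set B := RHS; have gB : g x *m B = 1%:M.
  rewrite gE /B; set M := gc x *m (gc x)^T.
  have MM : M *m M = slope2 x *: M.
    by rewrite /M -mulmxA [X in gc x *m X]mulmxA fsqE mul_scalar_mx -scalemxAr.
  rewrite mulmxDl mul1mx mulmxBr mulmx1 -scalemxAr MM scalerA ts.
  by rewrite scalerBl scale1r opprB [M + _]addrC !subrK.
have [ug _] := mulmx1_unit gB.
by rewrite /metric_inv -[RHS](mulKmx ug) gB mulmx1.
Qed.

Let ginvE i j x :
  metric_inv g x i j = (i == j)%:R - tilt x ^+ 2 * (f_ i x * f_ j x).
Proof. by rewrite graph_metric_inv !mxE big_ord1 !mxE. Qed.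

(** The gradient is an eigenvector of the metric, with eigenvalue 1 + |Df|^2. *)
Lemma ginv_grad x : metric_inv g x *m (grad f x)^T = tilt x ^+ 2 *: (grad f x)^T.
Proof.
rewrite graph_metric_inv mulmxBl mul1mx -scalemxAl -mulmxA fsqE mul_mx_scalar.
rewrite scalerA -[X in X - _]scale1r -scalerBl; congr (_ *: _).
by rewrite -[X in X - _](tilt_sqr x); ring.
Qed.

Lemma trmx_metric_inv x : (metric_inv g x)^T = metric_inv g x.
Proof.
by apply/matrixP => i j; rewrite mxE !ginvE eq_sym [f_ j x * _]mulrC.
Qed.

Lemma trmx_hess x : (hess x)^T = hess x.
Proof. by apply/matrixP => i j; rewrite !mxE; exact: BC. Qed.

(** Matrix determinant lemma: multiplication by the unitriangular [C1] and [C3] trades the block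
    [g x] for the 1 by 1 block 1 + |Df|^2. *)
Lemma det_graph_metric x : \det (g x) = 1 + slope2 x.
Proof.
pose C1 : 'M[R]_(n + 1) := block_mx 1%:M 0 (gc x)^T 1%:M.
pose C2 : 'M[R]_(n + 1) := block_mx (g x) (gc x) 0 1%:M.
pose C3 : 'M[R]_(n + 1) := block_mx 1%:M 0 (- (gc x)^T) 1%:M.
have : \det (C1 *m C2 *m C3) = \det (block_mx 1%:M (gc x) 0 (1 + slope2 x)%:M).
  congr (\det _); rewrite /C1 /C2 /C3 !mulmx_block.
  rewrite !(mul1mx, mulmx1, mul0mx, mulmx0, addr0, add0r, mulmxN).
  have -> : (1 + slope2 x)%:M = (gc x)^T *m gc x + 1%:M.
    by rewrite fsqE addrC raddfD.
  congr block_mx; first by rewrite gE addrK.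
  rewrite gE mulmxDr mulmx1 mulmxDl mul1mx mulmxA [X in X - _]addrC.
  by rewrite subrr.
rewrite !det_mulmx !det_lblock !det_ublock !det1 det_scalar1.
by rewrite !(mul1r, mulr1).
Qed.

Lemma dmetric_graph l j k x :
  dmetric g l j k x = B_ l j x * f_ k x + f_ j x * B_ l k x.
Proof.
apply: partialE; rewrite (_ : (fun _ => _) =
    fun y => (j == k)%:R + f_ j y * f_ k y); last first.
  by apply/funext => y; rewrite mxE.
exact/is_derive_cstD/is_derive_mul.
Qed.

(** In the sum of three derivatives of the metric, symmetry of the Hessian leaves only 2 f_s f_jk;
    raising the index s of the gradient gives the factor tilt^2. *)
Lemma christoffel_graph m j k x :
  christoffel g m j k x = tilt x ^+ 2 * f_ m x * B_ j k x.
Proof.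
have -> : tilt x ^+ 2 * f_ m x = \sum_s metric_inv g x m s * f_ s x.
  transitivity ((metric_inv g x *m gc x) m 0); first by rewrite ginv_grad !mxE.
  by rewrite mxE; apply: eq_bigr => s _; rewrite [gc x s 0]mxE [_ 0 s]mxE.
rewrite /christoffel mulr_sumr mulr_suml; apply: eq_bigr => s _.
rewrite !dmetric_graph (BC s j) (BC s k) (BC k j).
move: (metric_inv g x m s) => a.
move: (partial s f x) (partial j f x) (partial k f x) => u v w.
by move: (B_ j s x) (B_ k s x) (B_ j k x) => p q r; field; exact: isT.
Qed.

Let c_ i x := \sum_s f_ s x * B_ i s x.

Lemma riemann_mixed_graph i j k m x :
  riemann_mixed g i j k m x =
  tilt x ^+ 2 * (B_ i m x * B_ j k x - B_ j m x * B_ i k x)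
  - tilt x ^+ 4 * f_ m x * (c_ i x * B_ j k x - c_ j x * B_ i k x).
Proof.
have dG a b : is_derive x 'e_a (christoffel g m b k)
   (- 2 * tilt x ^+ 4 * c_ a x * f_ m x * B_ b k x
    + tilt x ^+ 2 * B_ a m x * B_ b k x + tilt x ^+ 2 * f_ m x * partial a (B_ b k) x).
  rewrite (_ : christoffel g m b k =
    fun y => tilt y * tilt y * f_ m y * B_ b k y); last first.
    by apply/funext => y; rewrite christoffel_graph expr2.
  apply: is_derive_eq (is_derive_mul (is_derive_mul (is_derive_mul
    (is_derive_tilt a x) (is_derive_tilt a x)) (d1 a m x)) (d2 a b k x)) _.
  rewrite -/(c_ a x); move: (partial a (B_ b k) x) => d3.
  move: (B_ b k x) (B_ a m x) (f_ m x) (c_ a x) (tilt x) => h h' u c t.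
  by ring.
rewrite /riemann_mixed (partialE (dG i j)) (partialE (dG j i)).
rewrite (_ : partial i (B_ j k) x = partial j (B_ i k) x); last first.
  by apply: smooth_partialC; exact: smooth_partial.
rewrite (eq_bigr _ (fun s _ => congr2 (fun a b => a - b)
  (congr2 *%R (christoffel_graph m i s x) (christoffel_graph s j k x))
  (congr2 *%R (christoffel_graph m j s x) (christoffel_graph s i k x)))).
exact: (mixed_riemann_algebra (fun s => f_ s x) (fun a b => B_ a b x)).
Qed.

(** The Gauss equation, with second fundamental form D^2 f / V. *)
Lemma riemann_graph i j k l x :
  riemann g i j k l x = Riem (tilt x *: hess x) i j k l.
Proof.
have E m : g x k m * riemann_mixed g i j l m x =
  ((k == m)%:R + f_ k x * f_ m x) *
  (tilt x ^+ 2 * (B_ i m x * B_ j l x - B_ j m x * B_ i l x)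
  - tilt x ^+ 4 * f_ m x * (c_ i x * B_ j l x - c_ j x * B_ i l x)).
  by rewrite mxE riemann_mixed_graph.
rewrite /riemann (eq_bigr _ (fun m _ => E m)) /Riem !mxE.
exact: (lower_riemann_algebra (u := fun s => f_ s x) (fun a b => B_ a b x)
  _ _ _ _ (tilt_sqr x)).
Qed.

(** The product rule for f_m / V and the explicit inverse metric both give tilt f_mi - tilt^3 f_m
    c_i. *)
Lemma shapeE x : shape x = metric_inv g x *m (tilt x *: hess x).
Proof.
apply/matrixP => m i; rewrite mxE.
rewrite (partialE (is_derive_mul (is_derive_tilt i x) (d1 i m x))).
rewrite graph_metric_inv mulmxBl mul1mx -scalemxAl -scalemxAr scalerA -mulmxA.
have E : (gc x *m ((gc x)^T *m hess x)) m i = f_ m x * c_ i x.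
  rewrite mxE big_ord1 !mxE; congr (_ * _); apply: eq_bigr => s _.
  by rewrite !mxE (BC i s).
rewrite [RHS]mxE [X in _ = X + _]mxE [X in _ = _ + X]mxE [X in _ = _ - X]mxE E.
rewrite [hess x m i]mxE -/(c_ i x) (BC m i).
by move: (tilt x) (c_ i x) (f_ m x) (B_ i m x) => t c u h; ring.
Qed.

End graph_geometry.

(** * Newton tensors *)

Section newton_tensors.
Context {R : realFieldType} {n : nat}.
Implicit Types S : 'M[R]_n.

(** [sigma2] and [sigma3] are the elementary symmetric functions of the eigenvalues, expressed by
    traces of powers. *)
Definition sigma2 S : R := 2^-1 * (\tr S ^+ 2 - \tr (S *m S)).

Definition sigma3 S : R :=
  6^-1 * (\tr S ^+ 3 - 3 * \tr S * \tr (S *m S) + 2 * \tr (S *m (S *m S))).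

(** The recursion T_k = sigma_k I - T_(k-1) S, started at T_0 = I, is kept unexpanded because the
    divergence argument descends along it. *)
Definition newton1 S : 'M[R]_n := \tr S *: 1%:M - S.
Definition newton2 S : 'M[R]_n := sigma2 S *: 1%:M - newton1 S *m S.
Definition newton3 S : 'M[R]_n := sigma3 S *: 1%:M - newton2 S *m S.

Lemma newton2E S : newton2 S = sigma2 S *: 1%:M - \tr S *: S + S *m S.
Proof.
by rewrite /newton2 /newton1 mulmxBl -scalemxAl mul1mx opprB addrA addrAC.
Qed.

Lemma newton3E S :
  newton3 S = sigma3 S *: 1%:M - sigma2 S *: S + \tr S *: (S *m S) - S *m (S *m S).
Proof.
rewrite /newton3 newton2E mulmxDl mulmxBl -!scalemxAl mul1mx mulmxA.
by rewrite !opprD opprK !addrA.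
Qed.

(** As tr (T_3 S) = 4 sigma_4, both sides are 24 sigma_4(S); the right side has the shape produced
    by [Riem_L2]. *)
Lemma newton3_trace S : 2 * (3 * \tr (newton3 S *m S)) =
  \tr S ^+ 4 - 6 * \tr S ^+ 2 * \tr (S *m S) + 3 * \tr (S *m S) ^+ 2
  + 8 * \tr S * \tr (S *m (S *m S)) - 6 * \tr (S *m (S *m (S *m S))).
Proof.
rewrite newton3E mulmxBl mulmxDl mulmxBl -!scalemxAl mul1mx.
rewrite raddfB /= raddfD /= raddfB /= !mxtraceZ -!mulmxA /sigma2 /sigma3.
move: (\tr S) (\tr (S *m S)) (\tr (S *m (S *m S))) (\tr (S *m (S *m (S *m S)))).
by move=> a b c d; field.
Qed.

(* The row divergence of a Newton tensor vanishes: D k stands for the k-th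
   partial derivative of S, and D k j m = D m j k because S is a Jacobian. *)
Lemma row_divergence_step S (T : 'M[R]_n) (D T' : 'I_n -> 'M[R]_n) :
  (forall i j k, D k j i = D i j k) ->
  (forall m, \sum_i T' i i m = 0) ->
  forall m, \sum_i (\tr (T *m D i) *: 1%:M - (T' i *m S + T *m D i)) i m = 0.
Proof.
move=> symD divT m.
(* [T' i] plays the i-th derivative of [T]: its sum vanishes by hypothesis, and the two sums with
   [T] cancel by the symmetry of [D]. *)
rewrite (eq_bigr (fun i => \tr (T *m D i) * (i == m)%:R
  - \sum_j T' i i j * S j m - \sum_j T i j * D i j m)); last first.
  by move=> i _; rewrite !mxE opprD addrA.
rewrite sumrB sumrB (bigD1 m)//= eqxx mulr1 big1 ?addr0; last first.
  by move=> i /negbTE ->; rewrite mulr0.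
rewrite [X in _ - X - _]exchange_big /= [X in _ - X - _]big1 ?subr0; last first.
  by move=> j _; rewrite -mulr_suml divT mul0r.
apply/eqP; rewrite subr_eq0; apply/eqP; apply: eq_bigr => i _; rewrite mxE.
by apply: eq_bigr => j _; rewrite (symD m).
Qed.

End newton_tensors.

(** * Derivatives of matrix-valued functions and of Newton tensors *)

Section matrix_derivation.
Context {R : realType} {V : normedModType R}.
Variables (x v : V).

Definition is_derive_mx p q (M : V -> 'M[R]_(p, q)) (dM : 'M[R]_(p, q)) :=
  forall i j, is_derive x v (fun y => M y i j) (dM i j).

Lemma is_derive_mxB p q (M N : V -> 'M[R]_(p, q)) dM dN :
  is_derive_mx M dM -> is_derive_mx N dN ->
  is_derive_mx (fun y => M y - N y) (dM - dN).
Proof.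
move=> hM hN i j; rewrite !mxE (_ : (fun _ => _) =
  (fun y => M y i j) - (fun y => N y i j)); first exact: is_deriveB.
by apply/funext => y; rewrite !mxE.
Qed.

Lemma is_derive_mulmx p q r (M : V -> 'M[R]_(p, q)) (N : V -> 'M[R]_(q, r)) dM dN :
  is_derive_mx M dM -> is_derive_mx N dN ->
  is_derive_mx (fun y => M y *m N y) (dM *m N x + M x *m dN).
Proof.
move=> hM hN i j; rewrite mxE [X in X + _]mxE [X in _ + X]mxE -big_split /=.
rewrite (_ : (fun _ => _) = fun y => \sum_k M y i k * N y k j).
  by apply: is_derive_bigsum => k; exact: is_derive_mul.
by apply/funext => y; rewrite mxE.
Qed.

Lemma is_derive_scalar_mx p (a : V -> R) da : is_derive x v a da ->
  is_derive_mx (fun y => a y *: 1%:M : 'M[R]_p) (da *: 1%:M).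
Proof.
move=> ha i j; rewrite !mxE (_ : (fun _ => _) = fun y => a y * (i == j)%:R).
  apply: is_derive_eq (is_derive_mul ha (is_derive_cst _ _ _)) _.
  by rewrite mulr0 addr0.
by apply/funext => y; rewrite !mxE.
Qed.

Lemma is_derive_mxtrace p (M : V -> 'M[R]_p) dM :
  is_derive_mx M dM -> is_derive x v (fun y => \tr (M y)) (\tr dM).
Proof. by move=> hM; apply: is_derive_bigsum => i; exact: hM. Qed.

Section newton_derivatives.
Context {n : nat}.
Variables (S : V -> 'M[R]_n) (D : 'M[R]_n).
Hypothesis dS : is_derive_mx S D.

Let s1 := is_derive_mxtrace dS.

Let s2 : is_derive x v (fun y => \tr (S y *m S y)) (2 * \tr (S x *m D)).
Proof.
apply: is_derive_eq (is_derive_mxtrace (is_derive_mulmx dS dS)) _.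
by rewrite mxtraceD (mxtrace_mulC D) -mulr2n mulr_natl.
Qed.

Let s3 : is_derive x v (fun y => \tr (S y *m (S y *m S y)))
  (3 * \tr (S x *m (S x *m D))).
Proof.
apply: is_derive_eq
  (is_derive_mxtrace (is_derive_mulmx dS (is_derive_mulmx dS dS))) _.
rewrite mulmxDr !mxtraceD (mxtrace_mulC D) -mulmxA.
rewrite (mxtrace_mulC (S x) (D *m S x)) -mulmxA (mxtrace_mulC D) -mulmxA.
by move: (\tr _) => t; ring.
Qed.

(** The case k = 2 of d sigma_k = tr (T_(k-1) dS); [is_derive_sigma3] is the case k = 3. *)
Lemma is_derive_sigma2 :
  is_derive x v (fun y => sigma2 (S y)) (\tr (newton1 (S x) *m D)).
Proof.
apply: is_derive_eq
  (is_derive_cstM 2^-1 (is_derive_sub (is_derive_mul s1 s1) s2)) _.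
rewrite /newton1 mulmxBl -scalemxAl mul1mx raddfB /= mxtraceZ.
by move: (\tr D) (\tr (S x)) (\tr (S x *m D)) => a b c; field.
Qed.

Lemma is_derive_sigma3 :
  is_derive x v (fun y => sigma3 (S y)) (\tr (newton2 (S x) *m D)).
Proof.
have := is_derive_cstM 6^-1 (is_derive_add (is_derive_sub
  (is_derive_mul s1 (is_derive_mul s1 s1))
  (is_derive_cstM 3 (is_derive_mul s1 s2))) (is_derive_cstM 2 s3)).
have -> : (fun y => 6^-1 * (\tr (S y) * (\tr (S y) * \tr (S y))
    - 3 * (\tr (S y) * \tr (S y *m S y)) + 2 * \tr (S y *m (S y *m S y))))
  = fun y => sigma3 (S y).
  by apply/funext => y; rewrite /sigma3; ring.
move=> ds; apply: (is_derive_eq ds).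
rewrite newton2E mulmxDl mulmxBl -!scalemxAl mul1mx mxtraceD raddfB /=.
rewrite !mxtraceZ -mulmxA /sigma2.
move: (\tr D) (\tr (S x)) (\tr (S x *m D)) (\tr (S x *m (S x *m D))) => a b c d.
by move: (\tr (S x *m S x)) => e; field.
Qed.

Lemma is_derive_newton1 :
  is_derive_mx (fun y => newton1 (S y)) (\tr D *: 1%:M - D).
Proof. by apply: is_derive_mxB => //; exact: is_derive_scalar_mx. Qed.

Lemma is_derive_newton2 : is_derive_mx (fun y => newton2 (S y))
  (\tr (newton1 (S x) *m D) *: 1%:M
   - ((\tr D *: 1%:M - D) *m S x + newton1 (S x) *m D)).
Proof.
apply: is_derive_mxB; first exact/is_derive_scalar_mx/is_derive_sigma2.
by apply: is_derive_mulmx => //; exact: is_derive_newton1.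
Qed.

(** The derivative retains the nesting of the recursion, so that [row_divergence_step] applies level
    by level. *)
Lemma is_derive_newton3 : is_derive_mx (fun y => newton3 (S y))
  (\tr (newton2 (S x) *m D) *: 1%:M
   - ((\tr (newton1 (S x) *m D) *: 1%:M
       - ((\tr D *: 1%:M - D) *m S x + newton1 (S x) *m D)) *m S x
      + newton2 (S x) *m D)).
Proof.
apply: is_derive_mxB; first exact/is_derive_scalar_mx/is_derive_sigma3.
by apply: is_derive_mulmx => //; exact: is_derive_newton2.
Qed.

End newton_derivatives.

End matrix_derivation.

(** * Smoothness of matrix-valued functions *)

Section smooth_matrices.
Context {R : realType} {n : nat}.

Definition smooth_mx p q (M : 'rV[R]_n -> 'M[R]_(p, q)) :=
  forall i j, smooth (fun y => M y i j).

Lemma smooth_mulmx p q r (M : 'rV[R]_n -> 'M[R]_(p, q))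
  (N : 'rV[R]_n -> 'M[R]_(q, r)) :
  smooth_mx M -> smooth_mx N -> smooth_mx (fun y => M y *m N y).
Proof.
move=> sM sN i j.
rewrite (_ : (fun _ => _) = fun y => \sum_k M y i k * N y k j).
  by apply: smooth_sum => k; exact: smoothM.
by apply/funext => y; rewrite mxE.
Qed.

Lemma smooth_mxB p q (M N : 'rV[R]_n -> 'M[R]_(p, q)) :
  smooth_mx M -> smooth_mx N -> smooth_mx (fun y => M y - N y).
Proof.
move=> sM sN i j; rewrite (_ : (fun _ => _) = fun y => M y i j - N y i j).
  exact: smoothB.
by apply/funext => y; rewrite !mxE.
Qed.

Lemma smooth_scalar_mx p (a : 'rV[R]_n -> R) :
  smooth a -> smooth_mx (fun y => a y *: 1%:M : 'M[R]_p).
Proof.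
move=> sa i j; rewrite (_ : (fun _ => _) = fun y => a y * (i == j)%:R).
  exact: smoothM sa (smooth_cst _).
by apply/funext => y; rewrite !mxE.
Qed.

Lemma smooth_mxtrace p (M : 'rV[R]_n -> 'M[R]_p) :
  smooth_mx M -> smooth (fun y => \tr (M y)).
Proof. by move=> sM; apply: smooth_sum => i; exact: sM. Qed.

Lemma smooth_newton3 p (S : 'rV[R]_n -> 'M[R]_p) :
  smooth_mx S -> smooth_mx (fun y => newton3 (S y)).
Proof.
move=> sS.
have s1 := smooth_mxtrace sS.
have s2 := smooth_mxtrace (smooth_mulmx sS sS).
have s3 := smooth_mxtrace (smooth_mulmx sS (smooth_mulmx sS sS)).
have sN1 : smooth_mx (fun y => newton1 (S y)).
  by apply: smooth_mxB sS; exact: smooth_scalar_mx.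
have sN2 : smooth_mx (fun y => newton2 (S y)).
  apply: (smooth_mxB _ (smooth_mulmx sN1 sS)).
  apply: smooth_scalar_mx; apply: (smoothM (smooth_cst _)).
  exact: smoothB (smoothM s1 s1) s2.
apply: (smooth_mxB _ (smooth_mulmx sN2 sS)).
apply: smooth_scalar_mx; apply: (smoothM (smooth_cst _)).
apply: smoothD (smoothM (smooth_cst 2) s3).
have s11 : smooth (fun y => \tr (S y) ^+ 3) by exact: smoothM (smoothM s1 s1).
exact: smoothB s11 (smoothM (smoothM (smooth_cst 3) s1) s2).
Qed.

End smooth_matrices.

(** * The flux density of a graph and its divergence *)

Section gauss_bonnet_graph.
Context {R : realType} {n : nat}.
Variable f : 'rV[R]_n -> R.
Hypothesis sf : smooth f.
Implicit Types (i j k l m : 'I_n) (x : 'rV[R]_n).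
Local Notation "''e_' i" := (delta_mx 0 i : 'rV[R]_n) (at level 8, i at level 2).
Local Notation g := (graph_metric f).

Let q x := metric_inv g x.
Let H x := tilt f x *: hess f x.
Let K x := q x *m H x *m q x.

Let sH x : (H x)^T = H x.
Proof. by rewrite linearZ /= trmx_hess. Qed.

Let sq x : (q x)^T = q x.
Proof. exact: trmx_metric_inv. Qed.

Let qH x : q x *m H x = shape f x.
Proof. by rewrite shapeE. Qed.

Let upE i j k l x :
  riemann_up g i j k l x = K x i k * K x j l - K x i l * K x j k.
Proof.
rewrite -(Riem_up (H x) (sq x)); do 4 (apply: eq_bigr => ? _).
by rewrite riemann_graph.
Qed.

Let ricE i k x :
  ricci g i k x = (\tr (shape f x) *: H x - H x *m q x *m H x) i k.
Proof.
rewrite -qH -(Riem_ricci (sq x) (sH x)); do 2 (apply: eq_bigr => ? _).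
by rewrite riemann_graph.
Qed.

Let ricupE i k x : ricci_up g i k x =
  (\tr (shape f x) *: K x - shape f x *m shape f x *m q x) i k.
Proof.
rewrite -qH -(Riem_ricci_up (H x) (sq x)); do 2 (apply: eq_bigr => ? _).
by rewrite ricE -qH.
Qed.

Let scE x : scalar_curvature g x =
  \tr (shape f x) ^+ 2 - \tr (shape f x *m shape f x).
Proof.
rewrite -qH -(Riem_scalar (sq x) (sH x)); do 2 (apply: eq_bigr => ? _).
by rewrite ricE -qH.
Qed.

(** Both sides are 24 sigma_4 of the shape operator, by [Riem_L2] and [newton3_trace]. *)
Lemma gauss_bonnet_L2_graph x :
  gauss_bonnet_L2 g x = 2 * (3 * \tr (newton3 (shape f x) *m shape f x)).
Proof.
rewrite newton3_trace -qH -(Riem_L2 (sq x) (sH x)) /gauss_bonnet_L2.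
congr (_ - 4 * _ + _ ^+ 2).
- by do 4 (apply: eq_bigr => ? _); rewrite riemann_graph// upE.
- by do 2 (apply: eq_bigr => ? _); rewrite ricE ricupE -qH.
- by rewrite scE -qH.
Qed.

Definition gbc_field i x : R :=
  3 * (newton3 (shape f x) *m \col_m normal f m x) i 0.

Lemma gauss_bonnet_P_graph i x :
  \sum_j \sum_k \sum_l gauss_bonnet_P g i j k l x * dmetric g l j k x
  = gbc_field i x.
Proof.
have t0 : tilt f x != 0 by rewrite gt_eqF// tilt_gt0.
(* Dividing the gradient by [tilt] cancels the factor [tilt] of [H], which yields the derivative of
   the metric, and makes its image under the inverse metric equal to N. *)
have E := Riem_P_contract (sq x) (sH x) ((tilt f x)^-1 *: (grad f x)^T) i.
rewrite /gbc_field newton3E -qH.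
have -> : \col_m normal f m x = q x *m ((tilt f x)^-1 *: (grad f x)^T).
  rewrite -scalemxAr ginv_grad scalerA expr2 mulrA mulVf// mul1r.
  by apply/colP => m; rewrite !mxE.
rewrite -[RHS]E; do 3 (apply: eq_bigr => ? _); congr (_ * _); last first.
  rewrite dmetric_graph// !mxE; move: t0.
  by move: (tilt f x) (partial _ _ x) (partial _ _ x) (partial _ _ x) => *; field.
by rewrite /gauss_bonnet_P upE !ricupE scE -/(q x) -qH.
Qed.

Lemma smooth_shape : smooth_mx (shape f).
Proof.
move=> m i; rewrite (_ : (fun _ => _) = partial i (normal f m)).
  by apply: smooth_partial; exact: smooth_normal.
by apply/funext => y; rewrite mxE.
Qed.

Let smooth_normal_col : smooth_mx (fun x => \col_m normal f m x).
Proof.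
move=> m j; rewrite (_ : (fun _ => _) = normal f m); first exact: smooth_normal.
by apply/funext => y; rewrite mxE.
Qed.

Lemma smooth_gbc_field i : smooth (gbc_field i).
Proof.
apply: (smoothM (smooth_cst 3)).
exact: (smooth_mulmx (smooth_newton3 smooth_shape) smooth_normal_col).
Qed.

Lemma div_gbc_field x :
  \sum_i partial i (gbc_field i) x = 2^-1 * gauss_bonnet_L2 g x.
Proof.
set S := shape f x.
pose D k : 'M[R]_n := \matrix_(m, i) partial k (partial i (normal f m)) x.
have dS k : is_derive_mx x 'e_k (shape f) (D k).
  move=> m i; rewrite mxE (_ : (fun _ => _) = partial i (normal f m)).
    by apply/smooth_is_derive/smooth_partial/smooth_normal.
  by apply/funext => y; rewrite mxE.
have symD i j k : D k j i = D i j k.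
  rewrite [LHS]mxE [RHS]mxE; apply: smooth_partialC; exact: smooth_normal.
have dN k : is_derive_mx x 'e_k (fun x => \col_m normal f m x) (col k S).
  move=> m j; rewrite !mxE (_ : (fun _ => _) = normal f m).
    exact/smooth_is_derive/smooth_normal.
  by apply/funext => y; rewrite mxE.
have dT k := is_derive_newton3 (dS k).
have dX i := is_derive_cstM 3 (is_derive_mulmx (dT i) (dN i) i 0).
rewrite (eq_bigr _ (fun i _ => partialE (dX i))) -mulr_sumr.
rewrite gauss_bonnet_L2_graph mulKf ?pnatr_eq0//; congr (3 * _).
(* By the product rule, differentiating N gives tr (T_3 S), while differentiating T_3 gives its row
   divergence paired with N, which is 0. *)
under eq_bigr do rewrite mxE; rewrite big_split /= [X in X + _](_ : _ = 0).
  rewrite add0r; apply: eq_bigr => i _; rewrite [LHS]mxE [RHS]mxE.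
  by apply: eq_bigr => j _; rewrite [col _ _ _ _]mxE.
under eq_bigr do rewrite mxE; rewrite exchange_big /= big1// => m _.
rewrite -mulr_suml (row_divergence_step S _ symD) ?mul0r//.
apply: (row_divergence_step S _ symD) => {}m.
(* The descent ends at T_0 = I, whose derivative is 0. *)
transitivity (\sum_i (\tr (1%:M *m D i) *: 1%:M - (0 *m S + 1%:M *m D i)) i m).
  by apply: eq_bigr => i _; rewrite mul0mx add0r !mul1mx.
by apply: (row_divergence_step S _ symD) => {}m; rewrite big1// => i _; rewrite mxE.
Qed.

End gauss_bonnet_graph.

(** * Measurability and integration along lines *)

Section row_vector_measurability.
Context {R : realType} {n : nat}.
Implicit Types (x y : 'rV[R]_n).

(** The sigma-algebra is generated by the coordinates, and an open set is the union of the countably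
    many cubes with rational centre and radius 1 / (m + 1) that it contains. *)
Lemma open_rV_measurable (U : set 'rV[R]_n) : open U -> measurable U.
Proof.
move=> oU.
pose cube (a : 'rV[rat]_n * nat) : set 'rV[R]_n :=
  [set x | forall i, `|x 0 i - ratr (a.1 0 i)| < a.2.+1%:R^-1].
have mcube a : measurable (cube a).
  rewrite (_ : cube a = \bigcap_(i : 'I_n) (fun x : 'rV[R]_n => x 0 i) @^-1`
      `]ratr (a.1 0 i) - a.2.+1%:R^-1, ratr (a.1 0 i) + a.2.+1%:R^-1[).
    apply: fin_bigcap_measurable => // i _.
    rewrite -[X in measurable X]setTI; exact: measurable_coord.
  apply/seteqP; split=> x /= h i.
    by move=> _; have := h i; rewrite /= in_itv /= ltr_distl.
  by have := h i Logic.I; rewrite /= in_itv /= ltr_distl.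
rewrite (_ : U = \bigcup_a (if `[< cube a `<=` U >] then cube a else set0)).
  apply: countable_bigcupT_measurable => // a.
  by case: ifP => _; [exact: mcube|exact: measurable0].
apply/seteqP; split=> [x Ux|x [a _]]; last first.
  by case: ifPn => // /asboolP; exact.
have /nbhs_ballP[e /= e0 xeU] : nbhs x U by move: oU; rewrite openE; exact.
(* A cube of radius below e / 2 that contains [x] lies in the sup-norm ball of radius [e] about
   [x]. *)
have [m me] : exists m : nat, m.+1%:R^-1 < e / 2.
  exists (Num.truncn (e / 2)^-1).
  rewrite invf_plt ?posrE ?divr_gt0//.
  exact: truncnS_gt.
have dm i : {q : rat | `|x 0 i - ratr q| < m.+1%:R^-1}.
  apply: cid; have : x 0 i - m.+1%:R^-1 < x 0 i + m.+1%:R^-1.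
    by rewrite ltrD2l gt0_cp// invr_gt0 ltr0n.
  move=> /rat_in_itvoo[q]; rewrite in_itv /= => /andP[q1 q2]; exists q.
  by rewrite distrC ltr_distl q1.
pose q : 'rV[rat]_n := \row_i sval (dm i).
exists (q, m) => //; case: ifPn => [_ i|/asboolPn[]].
  by rewrite /= mxE; exact: (svalP (dm i)).
move=> y yq; apply: xeU; split => // i j; rewrite (ord1 i) -ball_normE /=.
have := yq j; rewrite /= mxE distrC => h1.
have h2 := svalP (dm j); rewrite /= in h2.
rewrite (le_lt_trans (ler_distD (ratr (sval (dm j))) _ _))//.
by rewrite (lt_trans (ltrD h2 h1))// [ltRHS]splitr ltrD.
Qed.

Lemma continuous_rV_measurable (h : 'rV[R]_n -> R) :
  continuous h -> measurable_fun setT h.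
Proof.
move=> /continuousP ch; apply: (measurability _ (RGenOpens.measurableE R)).
move=> _ [_ [a [b ->] <-]]; rewrite setTI.
by apply: open_rV_measurable; apply: ch; exact: interval_open.
Qed.

Definition box (r : R) : set 'rV[R]_n := [set x | forall i, - r <= x 0 i <= r].

Lemma measurable_box r : measurable (box r).
Proof.
rewrite (_ : box r = \bigcap_(i : 'I_n) (fun x : 'rV[R]_n => x 0 i) @^-1` `[- r, r]).
  apply: fin_bigcap_measurable => // i _.
  rewrite -[X in measurable X]setTI; exact: measurable_coord.
apply/seteqP; split=> x /= h i; first by move=> _; rewrite /= in_itv; exact: h.
by have := h i Logic.I; rewrite /= in_itv.
Qed.

Lemma lebesgue_box_lty r : 0 <= r -> (lebesgue_rV R n (box r) < +oo)%E.
Proof.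
move=> r0; rewrite (_ : box r = [set x | forall i,
    (const_mx (- r) : 'rV[R]_n) 0 i <= x 0 i <= (const_mx r : 'rV[R]_n) 0 i]).
  by rewrite lebesgue_rV_box ?ltry// => i; rewrite !mxE ge0_cp.
by apply/seteqP; split=> x /= h i; have := h i; rewrite !mxE.
Qed.

Lemma bounded_box_integrable (h : 'rV[R]_n -> R) (D : set 'rV[R]_n) (r M : R) :
  measurable D -> 0 <= r -> D `<=` box r -> measurable_fun D h ->
  (forall x, D x -> `|h x| <= M) ->
  (lebesgue_rV R n).-integrable D (EFin \o h).
Proof.
move=> mD r0 Dr mh hM; apply: measurable_bounded_integrable => //.
  apply: le_lt_trans (lebesgue_box_lty r0); apply: le_measure => //;
  by rewrite inE//; exact: measurable_box.
by exists M; split; rewrite ?num_real// => N MN x Dx; exact: le_trans (hM x Dx) (ltW MN).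
Qed.

Lemma compact_box r : compact (box r).
Proof.
rewrite (_ : box r = [set v | forall i, v ord0 i \in `[- r, r]]).
  apply: (@rV_compact _ _ (fun=> `[- r, r]%classic)) => _.
  exact: segment_compact.
by apply/seteqP; split=> x /= h1 i; have := h1 i; rewrite in_itv.
Qed.

Lemma continuous_box_bounded (h : 'rV[R]_n -> R) (r : R) : 0 <= r ->
  continuous h -> exists2 M, 0 <= M & forall x, box r x -> `|h x| <= M.
Proof.
move=> r0 ch.
have cbox := @compact_box r.
have [||c _ Hc] := @compact_EVT_max _ R (fun x => `|h x|) (box r) _ cbox.
- by exists 0 => i; rewrite mxE ge0_cp.
- apply: continuous_subspaceT => x.
  exact: (continuous_comp (ch x) (@norm_continuous _ _ _)).
by exists `|h c| => // x bx; apply: Hc; rewrite inE.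
Qed.

End row_vector_measurability.

(** * Fubini's theorem along a coordinate direction *)

Section integral_along_lines.
Context {R : realType}.
Local Open Scope ereal_scope.
Local Notation mu := (@lebesgue_measure R).
Local Notation "''e_' i" := (delta_mx 0 i) (at level 8, i at level 2).

Lemma cons_rV_head n (p : R * 'rV[R]_n) : cons_rV p 0%R (0%R : 'I_n.+1) = p.1.
Proof. by have := congr1 fst (cons_rVK p). Qed.

Lemma cons_rV_tail n (p : R * 'rV[R]_n) (i : 'I_n) :
  cons_rV p 0%R (lift (0%R : 'I_n.+1) i) = p.2 0%R i.
Proof. by have := congr1 snd (cons_rVK p) => /rowP/(_ i); rewrite mxE. Qed.

Lemma cons_rV_addhead n (t : R) (y : 'rV[R]_n) :
  cons_rV (t, y) = (t *: 'e_0 + cons_rV (0, y))%R :> 'rV[R]_n.+1.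
Proof.
apply/rowP => i; rewrite [RHS]mxE [X in _ = (X + _)%R]mxE [X in _ = (_ * X + _)%R]mxE eqxx /=.
case: (unliftP 0%R i) => [j ->|->].
  by rewrite !cons_rV_tail eq_sym (negbTE (neq_lift _ _)) mulr0 add0r.
by rewrite !cons_rV_head eqxx mulr1 addr0.
Qed.

Lemma cons_rV_addtail n (t s : R) (j : 'I_n) (y : 'rV[R]_n) :
  cons_rV (t, s *: 'e_j + y)%R = (s *: 'e_(lift 0 j) + cons_rV (t, y))%R
    :> 'rV[R]_n.+1.
Proof.
apply/rowP => i; rewrite [RHS]mxE [X in _ = (X + _)%R]mxE [X in _ = (_ * X + _)%R]mxE eqxx /=.
case: (unliftP 0%R i) => [k ->|->].
  by rewrite !cons_rV_tail !mxE eqxx /= (inj_eq lift_inj).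
by rewrite !cons_rV_head (negbTE (neq_lift _ _)) mulr0 add0r.
Qed.

Section cons_fubini.
Variables (n : nat) (h : 'rV[R]_n.+1 -> R).
Hypotheses (mh : measurable_fun setT h)
  (ih : (lebesgue_rV R n.+1).-integrable setT (EFin \o h)).

Let hc : R * 'rV[R]_n -> \bar R := fun p => (h (cons_rV p))%:E.

Let mhc : measurable_fun setT hc.
Proof.
by apply/measurable_EFinP; apply: measurableT_comp mh _; exact: measurable_cons_rV.
Qed.

Let ihc : (mu \x lebesgue_rV R n).-integrable setT hc.
Proof.
apply/integrableP; split => //; move/integrableP : ih => [_].
rewrite (_ : \int[_]_x _ = \int[pushforward (mu \x lebesgue_rV R n)
  (@cons_rV R n)]_x `|(EFin \o h) x|)//.
rewrite ge0_integral_pushforward//; first exact: measurable_cons_rV.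
by apply/measurable_EFinP; exact: measurableT_comp.
Qed.

Let integral_cons : \int[lebesgue_rV R n.+1]_x (h x)%:E =
  \int[mu \x lebesgue_rV R n]_p hc p.
Proof.
rewrite (_ : \int[_]_x _ = \int[pushforward (mu \x lebesgue_rV R n)
  (@cons_rV R n)]_x (EFin \o h) x)//.
rewrite integral_pushforward//; first exact: measurable_cons_rV.
exact/measurable_EFinP.
Qed.

Lemma integral_cons_head : \int[lebesgue_rV R n.+1]_x (h x)%:E =
  \int[mu]_t \int[lebesgue_rV R n]_y (h (cons_rV (t, y)))%:E.
Proof. by rewrite integral_cons -integral12_prod_meas1. Qed.

Lemma integral_cons_tail : \int[lebesgue_rV R n.+1]_x (h x)%:E =
  \int[lebesgue_rV R n]_y \int[mu]_t (h (cons_rV (t, y)))%:E.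
Proof. by rewrite integral_cons -integral21_prod_meas1. Qed.

End cons_fubini.

(** Induction on the dimension. If [i] is the first coordinate, it is integrated innermost;
    otherwise the first coordinate is frozen and the induction hypothesis applies to the slice.
    Boundedness and support in a box justify Fubini. *)
Lemma integral_lines_eq0 n (i : 'I_n) (h : 'rV[R]_n -> R) (r M : R) :
  (0 <= r)%R -> measurable_fun setT h -> (forall x, `|h x| <= M)%R ->
  (forall x, h x != 0%R -> box r x) ->
  (forall y : 'rV[R]_n, y 0%R i = 0%R -> \int[mu]_t (h (t *: 'e_i + y)%R)%:E = 0) ->
  \int[lebesgue_rV R n]_x (h x)%:E = 0.
Proof.
move=> r0; elim: n i h => [[]//|n IH] i h mh hM hr h0.
have ih : (lebesgue_rV R n.+1).-integrable setT (EFin \o h).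
  rewrite (_ : EFin \o h = (EFin \o h) \_ (box r)).
    have mb : measurable (box r : set 'rV[R]_n.+1) := @measurable_box R n.+1 r.
    apply/(integrable_mkcond _ mb).
    apply: (@bounded_box_integrable _ _ _ _ r M) => //.
    exact: measurable_funTS.
  apply/funext => x; rewrite patchE; case: ifPn => // /negP; rewrite inE => nb.
  by congr EFin; apply/eqP/negPn/negP => /hr.
case: (unliftP 0%R i) => [j|] iE; rewrite {}iE in h0.
- rewrite integral_cons_head//; apply: integral0_eq => t _.
  apply: (IH j) => [|y|y hy|y yj].
  + apply: measurableT_comp mh _.
    apply: (measurableT_comp (@measurable_cons_rV R n)).
    exact: measurable_pair1.
  + exact: hM.
  + by move=> k; have := hr _ hy (lift 0%R k); rewrite cons_rV_tail.
  + under eq_integral do rewrite cons_rV_addtail.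
    by apply: h0; rewrite cons_rV_tail.
- rewrite integral_cons_tail//; apply: integral0_eq => y _.
  under eq_integral do rewrite cons_rV_addhead.
  by apply: h0; rewrite cons_rV_head.
Qed.

End integral_along_lines.

(** * Balls *)

Section ball_integrals.
Context {R : realType} {n : nat}.
Implicit Types (x y : 'rV[R]_n) (r s t : R) (i : 'I_n).
Local Notation leb := (lebesgue_rV R n).
Local Notation "''e_' i" := (delta_mx 0 i : 'rV[R]_n) (at level 8, i at level 2).

Definition cball r : set 'rV[R]_n := [set x | enorm x <= r].

Lemma enorm_ge0 x : 0 <= enorm x.
Proof. exact: sqrtr_ge0. Qed.

Lemma enorm_sqr x : enorm x ^+ 2 = \sum_i x 0 i ^+ 2.
Proof. by rewrite sqr_sqrtr// sumr_ge0// => i _; exact: sqr_ge0. Qed.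

Lemma coord_le_enorm x i : `|x 0 i| <= enorm x.
Proof.
rewrite -ler_sqr ?nnegrE ?enorm_ge0// real_normK ?num_real// enorm_sqr.
by rewrite (bigD1 i)//= lerDl sumr_ge0// => j _; exact: sqr_ge0.
Qed.

Lemma enormZ t x : enorm (t *: x) = `|t| * enorm x.
Proof.
rewrite /enorm -sqrtr_sqr -sqrtrM ?sqr_ge0// mulr_sumr.
by congr (Num.sqrt _); apply: eq_bigr => i _; rewrite mxE exprMn.
Qed.

Lemma enorm_line i t y : y 0 i = 0 ->
  enorm (t *: 'e_i + y) ^+ 2 = t ^+ 2 + enorm y ^+ 2.
Proof.
move=> yi; rewrite !enorm_sqr (bigD1 i)//= [in RHS](bigD1 i)//= !mxE yi !eqxx.
rewrite mulr1 addr0 expr0n /= add0r; congr (_ + _); apply: eq_bigr => j ji.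
by rewrite !mxE (negbTE ji) mulr0 add0r.
Qed.

Lemma measurable_cball r : measurable (cball r).
Proof.
rewrite (_ : cball r = enorm @^-1` `]-oo, r]).
  by rewrite -[X in measurable X]setTI; exact: measurable_enorm.
by apply/seteqP; split=> x /=; rewrite in_itv.
Qed.

Lemma cball_box r : cball r `<=` box r.
Proof. by move=> x xr i; rewrite -ler_norml (le_trans (coord_le_enorm _ _)). Qed.

Lemma continuous_ball_integrable (h : 'rV[R]_n -> R) (D : set 'rV[R]_n) r :
  measurable D -> 0 <= r -> D `<=` cball r -> continuous h ->
  leb.-integrable D (EFin \o h).
Proof.
move=> mD r0 Dr ch; have [M M0 hM] := continuous_box_bounded r0 ch.
have Db : D `<=` box r by apply: subset_trans Dr _; exact: cball_box.
apply: (@bounded_box_integrable _ _ _ _ r M) => // [|x /Db]; last exact: hM.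
exact: measurable_funTS (continuous_rV_measurable ch).
Qed.

Lemma integral_segment_FTC (u du : R -> R) c : 0 <= c ->
  (forall t, is_derive t 1 u (du t)) -> continuous du ->
  u c = 0 -> u (- c) = 0 ->
  (\int[lebesgue_measure]_(t in `[(- c)%R, c]) (du t)%:E = 0)%E.
Proof.
(* The degenerate segment c = 0 is split off, since the fundamental theorem of calculus needs
   distinct endpoints. *)
rewrite le_eqVlt => /predU1P[<- _ _ _ _|c0 hu cdu uc uNc].
  by rewrite oppr0 set_itv1 integral_set1.
have cu : continuous u by move=> t; exact: is_derive1_continuous (hu t).
rewrite (@continuous_FTC2 _ du u) ?uc ?uNc ?subee//.
- by rewrite -subr_gt0 opprK addr_gt0.
- exact: continuous_subspaceT.
- split; first by move=> t _; have [] := hu t.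
  + exact/cvg_at_right_filter/cu.
  + exact/cvg_at_left_filter/cu.
- by move=> t _; rewrite derive1E; have [] := hu t.
Qed.

(** A line parallel to e_i misses the ball or meets it in a chord whose endpoints lie on the sphere,
    where [psi] vanishes. *)
Lemma integral_partial_ball (psi : 'rV[R]_n -> R) i r : 0 < r -> smooth psi ->
  (forall x, enorm x = r -> psi x = 0) ->
  (\int[leb]_(x in cball r) (partial i psi x)%:E = 0)%E.
Proof.
move=> r0 spsi psi0; have sdpsi := smooth_partial i spsi.
have cdpsi := smooth_continuous sdpsi.
have [M M0 hM] := continuous_box_bounded (ltW r0) cdpsi.
rewrite integral_mkcond restrict_EFin.
apply: (integral_lines_eq0 (i := i) (ltW r0) (M := M)) => [|x|x|y yi].
- apply/(measurable_restrictT _ (measurable_cball r)).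
  exact: measurable_funTS (continuous_rV_measurable cdpsi).
- rewrite patchE; case: ifPn => [|_]; last by rewrite normr0.
  by rewrite inE => /cball_box; exact: hM.
- by rewrite patchE; case: ifPn => [|_]; rewrite ?eqxx// inE => /cball_box.
(* Half the length of the chord through [y]; lines that miss the ball are dismissed before [c] is
   used. *)
pose c := Num.sqrt (r ^+ 2 - enorm y ^+ 2).
have lineE t : (t *: 'e_i + y \in cball r) = (t ^+ 2 + enorm y ^+ 2 <= r ^+ 2).
  apply/idP/idP; rewrite -(enorm_line t yi).
    by rewrite inE /cball /= => h; rewrite lerXn2r ?nnegrE ?enorm_ge0// ltW.
  by move=> h; rewrite inE /cball /= -ler_sqr ?nnegrE ?enorm_ge0// ltW.
have [ry|yr] := ltP (r ^+ 2) (enorm y ^+ 2).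
  apply: integral0_eq => t _; rewrite patchE lineE ifF//.
  by apply/negbTE; rewrite -ltNge (lt_le_trans ry)// lerDr sqr_ge0.
have c0 : 0 <= c by exact: sqrtr_ge0.
have c2 : c ^+ 2 = r ^+ 2 - enorm y ^+ 2 by rewrite sqr_sqrtr// subr_ge0.
have onS t : t ^+ 2 = c ^+ 2 -> enorm (t *: 'e_i + y) = r.
  move=> tc; apply/eqP; rewrite -(@eqrXn2 _ 2) ?enorm_ge0 ?(ltW r0)//.
  by rewrite (enorm_line t yi) tc c2 subrK.
pose u t := psi (t *: 'e_i + y); pose du t := partial i psi (t *: 'e_i + y).
transitivity (\int[lebesgue_measure]_(t in `[(- c)%R, c]) (du t)%:E)%E.
  rewrite [RHS]integral_mkcond restrict_EFin; apply: eq_integral => t _.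
  rewrite !patchE lineE; congr (if _ then _ else _)%:E.
  rewrite mem_setE in_itv /= -ler_norml -[in RHS]ler_sqr ?nnegrE//.
  by rewrite real_normK ?num_real// c2 lerBrDr.
apply: (@integral_segment_FTC u) => //.
- by move=> t; exact: smooth_line.
- by move=> t; exact: is_derive1_continuous (smooth_line _ _ _ sdpsi).
- by apply: psi0; rewrite onS.
- by apply: psi0; rewrite onS// sqrrN.
Qed.

End ball_integrals.

(** * Dilations *)

Section dilations.
Context {R : realType}.
Local Open Scope ereal_scope.
Local Notation mu := (@lebesgue_measure R).

Lemma integral_mscale d (T : measurableType d) (m : {measure set T -> \bar R})
    (k : {nonneg R}) (D : set T) (f : T -> \bar R) :
  measurable D -> m.-integrable D f ->
  \int[mscale k m]_(x in D) f x = k%:num%:E * \int[m]_(x in D) f x.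
Proof.
move=> mD ifD; have mf := measurable_int m ifD.
have mp := measurable_funepos mf; have mn := measurable_funeneg mf.
rewrite [LHS]integralE [in RHS]integralE (ge0_integral_mscale _ mD _ mp)//.
rewrite (ge0_integral_mscale _ mD _ mn)// [RHS]muleBr//.
exact: integrable_add_def.
Qed.

(** The rescaled pushforward agrees with Lebesgue measure on half-open intervals, hence everywhere
    by uniqueness. *)
Lemma lebesgue_measure_dilate (c : R) (c0 : (0 < c)%R) (A : set R) :
  measurable A -> mu A = c%:E * mu (( *%R c) @^-1` A).
Proof.
move=> mA.
have mc : measurable_fun setT ( *%R c : measurableTypeR R -> measurableTypeR R).
  exact: mulrl_measurable.
pose m' := mscale (NngNum (ltW c0))
  (measure_function_pushforward__canonical__measure_function_Measure mu mc).
rewrite -[RHS]/(m' A); apply: lebesgue_measure_unique => // _ [[a b] _ <-].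
rewrite /m' /= /mscale /=.
rewrite -[pushforward mu _ _]/(mu ( *%R c @^-1` `]a, b])).
rewrite (_ : _ @^-1` _ = `](a / c)%R, (b / c)%R]%classic); last first.
  by apply/seteqP; split=> t /=; rewrite !in_itv /= ltr_pdivrMr// ler_pdivlMr// mulrC.
rewrite !lebesgue_measure_itv /= !lte_fin ltr_pM2r ?invr_gt0//.
case: ifP => _; last by rewrite mule0.
by rewrite -!EFinB -EFinM -mulrBl mulrC divfK// gt_eqF.
Qed.

Lemma measurable_scale_rV n (c : R) :
  measurable_fun setT ( *:%R c : 'rV[R]_n -> 'rV[R]_n).
Proof.
apply: measurable_fun_rV => i.
rewrite (_ : (fun _ => _) = (fun x : 'rV[R]_n => c * x 0%R i)%R).
  by apply: measurable_funM => //; exact: measurable_coord.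
by apply/funext => x; rewrite mxE.
Qed.

(** Induction on n: the rescaled pushforward [m'] agrees with the product measure on rectangles, and
    these determine it. *)
Lemma lebesgue_rV_dilate n (c : R) (c0 : (0 < c)%R) (A : set 'rV[R]_n) :
  measurable A ->
  lebesgue_rV R n A = (c ^+ n)%:E * lebesgue_rV R n (( *:%R c) @^-1` A).
Proof.
elim: n A => [|n IH] A mA.
  rewrite expr0 mul1e; congr (_ _).
  by apply/seteqP; split=> x /=; rewrite (thinmx0 (c *: x)) (thinmx0 x).
have mZ : measurable_fun setT ( *:%R c : 'rV[R]_n -> 'rV[R]_n).
  exact: measurable_scale_rV.
pose phi (p : measurableTypeR R * 'rV[R]_n) : measurableTypeR R * 'rV[R]_n :=
  (c * p.1, c *: p.2)%R.
have mphi : measurable_fun setT phi.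
  apply/measurable_fun_pairP; split.
    exact: (measurableT_comp (mulrl_measurable c) measurable_fst).
  exact: (measurableT_comp mZ measurable_snd).
pose m' := mscale (NngNum (exprn_ge0 n.+1 (ltW c0)))
  (measure_function_pushforward__canonical__measure_function_Measure
    (mu \x lebesgue_rV R n) mphi).
have mcA : measurable (@cons_rV R n @^-1` A).
  by rewrite -[X in measurable X]setTI; exact: measurable_cons_rV.
have m'E (A1 : set (measurableTypeR R)) (A2 : set 'rV[R]_n) : measurable A1 -> measurable A2 ->
    m' (A1 `*` A2) = mu A1 * lebesgue_rV R n A2.
  move=> mA1 mA2; rewrite /m' /= /mscale /=.
  rewrite -[pushforward _ _ _]/((mu \x lebesgue_rV R n)
    (( *%R c @^-1` A1) `*` ( *:%R c @^-1` A2))).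
  rewrite product_measure1E//; last 2 first.
  - by rewrite -[X in measurable X]setTI; exact: mulrl_measurable.
  - by rewrite -[X in measurable X]setTI; exact: mZ.
  rewrite (lebesgue_measure_dilate c0 mA1) (IH _ mA2) exprS EFinM.
  by rewrite muleACA.
have -> : lebesgue_rV R n.+1 A = (mu \x lebesgue_rV R n) (@cons_rV R n @^-1` A).
  by [].
rewrite (product_measure_unique m'E mcA) /m' /= /mscale /=; congr (_ * _).
rewrite -[LHS]/((mu \x lebesgue_rV R n) (phi @^-1` (@cons_rV R n @^-1` A))).
rewrite -[RHS]/((mu \x lebesgue_rV R n) (@cons_rV R n @^-1` ( *:%R c @^-1` A))).
congr (_ _); apply/seteqP; suff E p : cons_rV (phi p) = (c *: cons_rV p)%R.
  by split=> p /=; rewrite E.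
apply/rowP => i; rewrite [RHS]mxE; case: (unliftP 0%R i) => [j ->|->].
  by rewrite !cons_rV_tail mxE.
by rewrite !cons_rV_head.
Qed.

Lemma Rintegral_dilate n (c : R) (c0 : (0 < c)%R) (h : 'rV[R]_n -> R)
    (D : set 'rV[R]_n) : measurable D -> measurable_fun setT h ->
  (lebesgue_rV R n).-integrable ( *:%R c @^-1` D) (EFin \o (h \o *:%R c)) ->
  (\int[lebesgue_rV R n]_(x in D) h x =
   c ^+ n * \int[lebesgue_rV R n]_(x in *:%R c @^-1` D) h (c *: x))%R.
Proof.
move=> mD mh ihc; have mZ := @measurable_scale_rV n c.
have mEh : measurable_fun setT (EFin \o h) by exact/measurable_EFinP.
pose m' := measure_function_pushforward__canonical__measure_function_Measure
  (lebesgue_rV R n) mZ.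
have ip : m'.-integrable D (EFin \o h) by exact: integrable_pushforward.
rewrite /Rintegral (@eq_measure_integral _ _ _ _
  (mscale (NngNum (exprn_ge0 n (ltW c0))) m')); last first.
  by move=> A mA _; exact: lebesgue_rV_dilate.
rewrite (integral_mscale _ mD ip) (fineM _ (integrable_fin_num mD ip))//=.
by congr (_ * fine _)%R; exact: (integral_pushforward mZ mEh ihc mD).
Qed.

End dilations.

(** * Integration over spheres *)

Section divergence_on_balls.
Context {R : realType} {n : nat}.
Implicit Types (x y : 'rV[R]_n) (r s t : R) (i : 'I_n).
Local Notation leb := (lebesgue_rV R n).

Lemma radial_proj_sphere r x : 0 < enorm x -> 0 <= r ->
  enorm (radial_proj r x) = r.
Proof.
move=> x0 r0; rewrite enormZ ger0_norm ?divr_ge0// ?ltW// divfK// gt_eqF//.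
Qed.

Lemma enorm_radial_proj_le r x : 0 <= r -> enorm (radial_proj r x) <= r.
Proof.
move=> r0; have [x0|] := ltP 0 (enorm x); first by rewrite radial_proj_sphere.
move=> x0; have e0 : enorm x = 0 by apply/eqP; rewrite eq_le x0 enorm_ge0.
by rewrite enormZ e0 mulr0.
Qed.

Lemma radial_projZ r c x : 0 < c -> radial_proj r (c *: x) = radial_proj r x.
Proof.
move=> c0; rewrite /radial_proj enormZ scalerA gtr0_norm// invfM mulrA mulrAC.
by rewrite divfK ?gt_eqF.
Qed.

Lemma punctured_ball_cball r : punctured_ball r `<=` (cball r : set 'rV[R]_n).
Proof. by move=> x /andP[]. Qed.

(** The area measure is a multiple of the pushforward under [radial_proj] of Lebesgue measure
    restricted to the punctured ball, so this is a change of variables. *)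
Lemma Rintegral_sphere_area (u : 'rV[R]_n -> R) r : 0 < r -> continuous u ->
  \int[sphere_area r]_(x in sphere r) u x =
  n%:R / r * \int[leb]_(x in punctured_ball r) u (radial_proj r x).
Proof.
move=> r0 cu.
pose m1 := mrestr leb (@measurable_punctured_ball R n r).
pose m2 := measure_function_pushforward__canonical__measure_function_Measure
  m1 (@measurable_radial_proj R n r).
have ms : measurable (sphere r : set 'rV[R]_n).
  rewrite (_ : sphere r = @enorm R n @^-1` [set r])//.
  by rewrite -[X in measurable X]setTI; exact: measurable_enorm.
have mEu : measurable_fun setT (EFin \o u).
  by apply/measurable_EFinP; exact: continuous_rV_measurable cu.
have mpb : measurable (punctured_ball r : set 'rV[R]_n).
  exact: measurable_punctured_ball.
set E := radial_proj r @^-1` sphere r : set 'rV[R]_n.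
have mE : measurable E.
  by rewrite -[X in measurable X]setTI; exact: measurable_radial_proj.
have [M M0 uM] := continuous_box_bounded (ltW r0) cu.
have iu : m1.-integrable E ((EFin \o u) \o radial_proj r).
  apply: measurable_bounded_integrable => //.
  - rewrite /m1 /= /mrestr; apply: le_lt_trans (@lebesgue_box_lty R n r (ltW r0)).
    apply: le_measure; rewrite ?inE.
    + exact: measurableI.
    + exact: measurable_box.
    + by move=> x [_ /punctured_ball_cball /cball_box].
  - apply: (measurableT_comp (continuous_rV_measurable cu)).
    exact: measurable_funTS (@measurable_radial_proj R n r).
  - exists M; split; rewrite ?num_real// => N MN x _ /=.
    apply: le_trans (ltW MN); apply: uM; apply: cball_box.
    exact/enorm_radial_proj_le/ltW.
have iu2 : m2.-integrable (sphere r) (EFin \o u).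
  exact: (integrable_pushforward (@measurable_radial_proj R n r) mEu iu ms).
have PE : punctured_ball r `<=` E.
  by move=> x /andP[x0 _]; exact: radial_proj_sphere x0 (ltW r0).
rewrite /Rintegral.
transitivity (fine (\int[mscale (n%:R / `|r|)%:nng m2]_(x in sphere r) (u x)%:E)).
  by congr fine; exact: eq_measure_integral.
rewrite (integral_mscale _ ms iu2) (fineM _ (integrable_fin_num ms iu2))//=.
congr (_ * fine _); first by rewrite gtr0_norm.
transitivity (\int[m1]_(x in E) (u (radial_proj r x))%:E)%E.
  exact: (integral_pushforward (@measurable_radial_proj R n r) mEu iu ms).
(* The restricted measure does not charge the complement of the punctured ball, so the domain
   shrinks to that ball. *)
rewrite (negligible_integral (measurableC mpb) mE iu); last first.
  by rewrite /m1 /= /mrestr setICl measure0.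
rewrite setDE setCK (setIidr PE).
apply: eq_measure_integral => A mA AP.
by rewrite /m1 /= /mrestr (setIidl AP).
Qed.

Section field.
Variable X : 'I_n -> 'rV[R]_n -> R.
Hypothesis sX : forall i, smooth (X i).

Definition divergence x : R := \sum_i partial i (X i) x.
(** On the sphere of radius r this is r times the normal component of [X]. *)
Definition radial_part x : R := \sum_i X i x * x 0 i.

Lemma smooth_divergence : smooth divergence.
Proof. by apply: smooth_sum => i; exact: smooth_partial. Qed.

Lemma smooth_radial_part : smooth radial_part.
Proof.
by apply: smooth_sum => i; apply: smoothM; [exact: sX|exact: smooth_coord].
Qed.

(** Written with squared coordinates instead of [enorm], which makes its smoothness evident. *)
Definition weight r x : R := r ^+ 2 - \sum_i x 0 i ^+ 2.

Lemma smooth_weight r : smooth (weight r).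
Proof.
apply: smoothB; first exact: smooth_cst.
by apply: smooth_sum => i; apply: smoothM; exact: smooth_coord.
Qed.

Lemma weightE r x : weight r x = r ^+ 2 - enorm x ^+ 2.
Proof. by rewrite enorm_sqr. Qed.

Lemma is_derive_weight r i x :
  is_derive x (delta_mx 0 i) (weight r) (- 2 * x 0 i).
Proof.
have dc k := is_derive_coord i k x.
apply: (is_derive_eq (is_derive_sub (is_derive_cst (r ^+ 2 : R) _ _)
  (is_derive_bigsum _ (fun k => is_derive_mul (dc k) (dc k))))).
rewrite sub0r (bigD1 i)//= eqxx big1 ?addr0; last first.
  by move=> k ki; rewrite eq_sym (negbTE ki) mul0r mulr0 addr0.
by rewrite mul1r mulr1 mulNr mulr_natl mulr2n.
Qed.

(** The field [weight r] times [X] vanishes on the sphere, so its divergence integrates to 0; the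
    gradient of the weight is -2 x. *)
Lemma ball_weight_identity r : 0 < r ->
  \int[leb]_(x in cball r) (weight r x * divergence x)
  = 2 * \int[leb]_(x in cball r) radial_part x.
Proof.
move=> r0; pose psi i x := weight r x * X i x.
have spsi i : smooth (psi i) by exact: smoothM (smooth_weight r) (sX i).
have mb := @measurable_cball R n r.
have intB (u : 'rV[R]_n -> R) (su : smooth u) :
    leb.-integrable (cball r) (EFin \o u).
  by apply: continuous_ball_integrable (ltW r0) _ _ => //; exact: smooth_continuous.
have sum0 : (\int[leb]_(x in cball r) (\sum_i partial i (psi i) x)%:E = 0)%E.
  under eq_integral do rewrite -sumEFin.
  rewrite integral_sum//; last by move=> i; exact: intB (smooth_partial i (spsi i)).
  rewrite big1// => i _; apply: integral_partial_ball => // x xr.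
  by rewrite /psi weightE xr subrr mul0r.
have sumE x : \sum_i partial i (psi i) x =
    weight r x * divergence x - 2 * radial_part x.
  rewrite /divergence /radial_part !mulr_sumr -sumrB; apply: eq_bigr => i _.
  rewrite (partialE (is_derive_mul (is_derive_weight r i x)
    (smooth_is_derive i x (sX i)))).
  by move: (partial i (X i) x) => d; ring.
have := congr1 fine sum0; rewrite /=.
under eq_integral do rewrite sumE.
have swd : smooth (fun x => weight r x * divergence x).
  exact: smoothM (smooth_weight r) smooth_divergence.
have srp := smooth_radial_part.
have s2r : smooth (fun x => 2 * radial_part x) by exact: smoothM (smooth_cst 2) srp.
rewrite -[fine _]/(\int[leb]_(x in cball r)
  (weight r x * divergence x - 2 * radial_part x)).
rewrite (RintegralB mb (intB _ swd) (intB _ s2r)) (RintegralZl _ mb (intB _ srp)).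
by move/eqP; rewrite subr_eq0 => /eqP.
Qed.

End field.

End divergence_on_balls.

(** * Shells *)

Section shells.
Context {R : realType} {n : nat}.
Implicit Types (x y : 'rV[R]_n) (r s t c : R) (i : 'I_n).
Local Notation leb := (lebesgue_rV R n).

Lemma Rintegral_abs_le d (T : measurableType d) (m : {measure set T -> \bar R})
    (D : set T) (u : T -> R) (C : R) : measurable D ->
  m.-integrable D (EFin \o u) -> m.-integrable D (EFin \o cst 1) ->
  (forall z, D z -> `|u z| <= C) ->
  `|\int[m]_(z in D) u z| <= C * \int[m]_(z in D) 1.
Proof.
move=> mD iu i1 uC; apply: le_trans (le_normr_Rintegral mD iu) _.
rewrite -(RintegralZl _ mD i1); apply: le_Rintegral => //.
- exact: integrable_norm iu.
- exact: (integrableZl mD C i1).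
- by move=> x Dx; rewrite mulr1; exact: uC.
Qed.

Definition shell r s : set 'rV[R]_n := cball s `\` cball r.

Lemma measurable_shell r s : measurable (shell r s).
Proof. by apply: measurableD; exact: measurable_cball. Qed.

Lemma Rintegral_cball_shell r s (u : 'rV[R]_n -> R) : 0 <= r -> r <= s ->
  continuous u -> \int[leb]_(x in cball s) u x =
  \int[leb]_(x in cball r) u x + \int[leb]_(x in shell r s) u x.
Proof.
move=> r0 rs cu; have rss : cball r `<=` (cball s : set 'rV[R]_n).
  by move=> x /le_trans; exact.
have sE : cball s = cball r `|` shell r s by rewrite /shell setDUK.
rewrite {1}sE Rintegral_setU//.
- exact: measurable_cball.
- exact: measurable_shell.
- rewrite -sE; apply: (continuous_ball_integrable (r := s)) => //.
    exact: measurable_cball.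
  exact: le_trans r0 rs.
- by rewrite /shell disj_set2E setDIK.
Qed.

Section homogeneous.
Variables (b : 'rV[R]_n -> R) (M : R).
Hypotheses (mb : measurable_fun setT b) (bM : forall x, `|b x| <= M)
  (bZ : forall c x, 0 < c -> b (c *: x) = b x).

Let ib D r : measurable D -> 0 <= r -> D `<=` cball r ->
  leb.-integrable D (EFin \o b).
Proof.
move=> mD r0 Dr.
have Db : D `<=` box r by apply: subset_trans Dr _; exact: cball_box.
apply: (@bounded_box_integrable _ _ _ _ r M) => //; exact: measurable_funTS mb.
Qed.

(** Dilation by [c] multiplies the integral over the punctured ball by c^n, and the shell is the
    difference of the two punctured balls. *)
Lemma Rintegral_shell c r : 0 < r -> 1 < c ->
  \int[leb]_(x in shell r (c * r)) b x =
  (c ^+ n - 1) * \int[leb]_(x in punctured_ball r) b x.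
Proof.
move=> r0 c1; have c0 : 0 < c by exact: lt_trans c1.
have rcr : r <= c * r by rewrite ler_peMl ?ltW.
have mp := @measurable_punctured_ball R n.
have cE : *:%R c @^-1` punctured_ball (c * r) = punctured_ball r :> set 'rV[R]_n.
  apply/seteqP; split=> x; rewrite /punctured_ball /= enormZ gtr0_norm//;
  by rewrite pmulr_rgt0// ler_pM2l.
have dil : \int[leb]_(x in punctured_ball (c * r)) b x
    = c ^+ n * \int[leb]_(x in punctured_ball r) b x.
  rewrite (Rintegral_dilate c0 (mp _) mb) cE.
    by congr (_ * _); apply: eq_Rintegral => x _; exact: bZ.
  rewrite (_ : b \o _ = b); last by apply/funext => x; exact: bZ.
  by apply: (ib _ (ltW r0)); [exact: mp|exact: punctured_ball_cball].
have pE : punctured_ball (c * r) = punctured_ball r `|` shell r (c * r)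
    :> set 'rV[R]_n.
  apply/seteqP; split=> x; rewrite /punctured_ball /shell /cball /=.
    move=> /andP[x0 xc]; have [xr|xr] := leP (enorm x) r; first by left; rewrite x0.
    by right; split => //; apply/negP; rewrite -ltNge.
  move=> [/andP[-> xr]|[xc /negP]]; first by rewrite (le_trans xr).
  by rewrite -ltNge => xr; rewrite xc (lt_trans r0).
have : \int[leb]_(x in punctured_ball (c * r)) b x =
    \int[leb]_(x in punctured_ball r) b x + \int[leb]_(x in shell r (c * r)) b x.
  rewrite {1}pE Rintegral_setU//.
  - exact: measurable_shell.
  - rewrite -pE; apply: (@ib _ (c * r)); [exact: mp| |exact: punctured_ball_cball].
    exact: le_trans (ltW r0) rcr.
  - rewrite disj_set2E; apply/eqP/seteqP; split=> // x /= [/andP[_ xr] [_ nxr]].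
    exact: nxr.
by rewrite dil mulrBl mul1r => ->; rewrite addrC addKr.
Qed.

End homogeneous.

End shells.

(** * The divergence theorem on balls *)

Section divergence_theorem.
Context {R : realType} {n : nat}.
Implicit Types (x y : 'rV[R]_n) (r s t c : R) (i : 'I_n).
Local Notation leb := (lebesgue_rV R n).

(** Joint continuity of a(x) - a(c x) at c = 1, made uniform in x by compactness of the box. *)
Lemma radially_uniform (a : 'rV[R]_n -> R) r e : continuous a -> 0 <= r -> 0 < e ->
  \forall c \near (1 : R), forall x, box r x -> `|a x - a (c *: x)| <= e.
Proof.
move=> ca r0 e0.
have cbox := @compact_box R n r.
have := (compact_near_coveringP _).1 cbox R (nbhs (1 : R))
  (fun c x => `|a x - a (c *: x)| <= e) _.
apply => x _.
have h : (fun p : 'rV[R]_n * R => a p.1 - a (p.2 *: p.1)) @ (x, 1 : R) --> (0 : R).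
  rewrite (_ : 0 = a x - a (1 *: x)); last by rewrite scale1r subrr.
  apply: cvgB.
    apply: (@cvg_comp _ _ _ fst a _ (nbhs x)); [exact: cvg_fst|exact: ca].
  apply: (@cvg_comp _ _ _ (fun p : 'rV[R]_n * R => p.2 *: p.1) a _ (nbhs (1 *: x))).
    by apply: cvgZ; [exact: cvg_snd|exact: cvg_fst].
  exact: ca.
have := (cvgr0Pnorm_le _).1 h e e0; move/(_ _) => H.
by apply: filterS H => -[y c].
Qed.

Variable X : 'I_n -> 'rV[R]_n -> R.
Hypothesis sX : forall i, smooth (X i).
Local Notation divX := (divergence X).
Local Notation a := (radial_part X).

Section fixed_radius.
Variable r : R.
Hypothesis r0 : 0 < r.

(** [b] extends the values of [a] on the sphere to a function homogeneous of degree 0. *)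
Let b x : R := a (radial_proj r x).
Let I := \int[leb]_(x in cball r) divX x.
Let J := \int[leb]_(x in punctured_ball r) b x.
Let m := \int[leb]_(x in punctured_ball r) 1.

Let sD : smooth divX := smooth_divergence sX.
Let sa : smooth a := smooth_radial_part sX.

Let mb : measurable_fun setT b.
Proof.
apply: (measurableT_comp (continuous_rV_measurable (smooth_continuous sa))).
exact: measurable_radial_proj.
Qed.

Let b_bounded : exists M, forall x, `|b x| <= M.
Proof.
have [M _ hM] := continuous_box_bounded (ltW r0) (smooth_continuous sa).
by exists M => x; apply/hM/cball_box/enorm_radial_proj_le/ltW.
Qed.

Let bZ c x : 0 < c -> b (c *: x) = b x.
Proof. by move=> c0; rewrite /b radial_projZ. Qed.

(** Difference of [ball_weight_identity] at the radii c r and r: on the inner ball the weights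
    differ by a constant, and over the shell [a] is replaced by [b], whose integral there is
    known. *)
Let shell_estimate c M e : 1 < c ->
  (forall x, cball (c * r) x -> `|divX x| <= M) ->
  (forall x, shell r (c * r) x -> `|a x - b x| <= e) ->
  `|r ^+ 2 * (c ^+ 2 - 1) * I - 2 * ((c ^+ n - 1) * J)|
  <= (r ^+ 2 * (c ^+ 2 - 1) * M + 2 * e) * ((c ^+ n - 1) * m).
Proof.
move=> c1 hM he; have c0 : 0 < c by exact: lt_trans c1.
have rcr : r <= c * r by rewrite ler_peMl ?ltW.
have cr0 : 0 < c * r by exact: lt_le_trans r0 rcr.
pose S : set 'rV[R]_n := shell r (c * r).
have mS : measurable S by exact: measurable_shell.
have Sc : S `<=` cball (c * r) by move=> x [].
have [Mb hMb] := b_bounded.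
have iS (u : 'rV[R]_n -> R) : smooth u -> leb.-integrable S (EFin \o u).
  by move=> /smooth_continuous; exact: continuous_ball_integrable (ltW cr0) Sc.
have iSb : leb.-integrable S (EFin \o b).
  have Sb : S `<=` box (c * r) by apply: subset_trans Sc _; exact: cball_box.
  apply: (@bounded_box_integrable _ _ _ _ _ Mb mS (ltW cr0) Sb) => //.
  exact: measurable_funTS mb.
have swD : smooth (fun x => weight (c * r) x * divX x).
  exact: smoothM (smooth_weight _) sD.
have swrD : smooth (fun x => weight r x * divX x).
  exact: smoothM (smooth_weight _) sD.
pose k := r ^+ 2 * (c ^+ 2 - 1).
have skD : smooth (fun x => k * divX x) by exact: smoothM (smooth_cst k) sD.
have k0 : 0 <= k by rewrite mulr_ge0 ?sqr_ge0// subr_ge0 expr_ge1// ltW.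
have E1 := ball_weight_identity sX cr0.
have E2 := ball_weight_identity sX r0.
rewrite (Rintegral_cball_shell (ltW r0) rcr (smooth_continuous swD)) in E1.
rewrite (Rintegral_cball_shell (ltW r0) rcr (smooth_continuous sa)) in E1.
have E3 : \int[leb]_(x in cball r) (weight (c * r) x * divX x) =
    \int[leb]_(x in cball r) (weight r x * divX x) + k * I.
  have mB := @measurable_cball R n r.
  have iB (u : 'rV[R]_n -> R) : smooth u -> leb.-integrable (cball r) (EFin \o u).
    by move=> /smooth_continuous; exact: continuous_ball_integrable (ltW r0) _.
  rewrite -(RintegralZl _ mB (iB _ sD)) -(RintegralD mB (iB _ swrD) (iB _ skD)).
  apply: eq_Rintegral => x _; rewrite !weightE /k; move: (divX x) => d.
  by rewrite exprMn; ring.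
have E4 : \int[leb]_(x in S) a x =
    \int[leb]_(x in S) (a x - b x) + (c ^+ n - 1) * J.
  rewrite -(Rintegral_shell mb hMb bZ r0 c1).
  by rewrite (RintegralB mS (iS _ sa) iSb) subrK.
have i1 : leb.-integrable S (EFin \o cst 1) by exact: (iS (fun=> 1) (smooth_cst 1)).
have m1 : \int[leb]_(x in S) 1 = (c ^+ n - 1) * m.
  apply: (@Rintegral_shell _ _ (cst 1) 1) => // x; by rewrite normr1.
have iab : leb.-integrable S (EFin \o (fun x => a x - b x)).
  have := integrableB mS (iS _ sa) iSb; apply: eq_integrable => // x _ /=.
have L1 := Rintegral_abs_le mS iab i1 he.
(* On the shell the weight decreases outwards from [k] at radius r to 0 at radius c r. *)
have wk x : S x -> `|weight (c * r) x * divX x| <= k * M.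
  move=> Sx; have [xc /negP] := Sx; rewrite -ltNge => xr.
  rewrite normrM; apply: ler_pM; rewrite ?normr_ge0//; last exact/hM/Sc.
  rewrite weightE ger0_norm.
    rewrite /k mulrBr mulr1 -exprMn mulrC lerB// lerXn2r ?nnegrE ?enorm_ge0// ltW//.
  by rewrite subr_ge0 lerXn2r ?nnegrE ?enorm_ge0// ltW.
have L2 := Rintegral_abs_le mS (iS _ swD) i1 wk.
rewrite -/k.
(* The quantity to bound consists exactly of the two error integrals over the shell. *)
have -> : k * I - 2 * ((c ^+ n - 1) * J) =
    2 * (\int[leb]_(x in S) (a x - b x))
    - \int[leb]_(x in S) (weight (c * r) x * divX x).
  rewrite E3 E2 E4 in E1; move: E1.
  move: (\int[leb]_(x in S) (a x - b x)) => A.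
  move: (\int[leb]_(x in S) (weight _ _ * _)) => B.
  move: (\int[leb]_(x in cball r) a x) => C.
  rewrite -/S; lra.
apply: (le_trans (ler_normB _ _)); rewrite normrM (ger0_norm (ler0n _ 2)) -m1.
apply: (le_trans (lerD (ler_wpM2l (ler0n _ 2) L1) L2)).
by rewrite le_eqVlt; apply/orP; left; apply/eqP; ring.
Qed.

(** [shell_estimate] divided by c - 1, which is possible since c^n - 1 is c - 1 times the geometric
    sum; only then does the limit c = 1 carry information. *)
Let scaled_estimate M e : 0 < e ->
  (forall x, cball (2 * r) x -> `|divX x| <= M) ->
  \forall c \near (1 : R)^'+,
    `|r ^+ 2 * (c + 1) * I - 2 * ((\sum_(i < n) c ^+ i) * J)|
    <= (r ^+ 2 * (c ^+ 2 - 1) * M + 2 * e) * ((\sum_(i < n) c ^+ i) * m).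
Proof.
move=> e0 hM; have r20 : 0 <= 2 * r by rewrite mulr_ge0// ltW.
have /nbhs_ballP[d /= d0 hd] :=
  radially_uniform (smooth_continuous sa) r20 e0.
near=> c.
have c1 : 1 < c by near: c; exact: nbhs_right_gt.
have c2 : c < 2 by near: c; apply: nbhs_right_lt; rewrite ltr1n.
have cd : c < 1 + d by near: c; apply: nbhs_right_lt; rewrite ltrDl.
have c0 : 0 < c by exact: lt_trans c1.
have sub2 x : cball (c * r) x -> cball (2 * r) x.
  by move=> xc; apply: (le_trans xc); rewrite ler_wpM2r ?ltW.
have est : forall x, shell r (c * r) x -> `|a x - b x| <= e.
  move=> x [xc /negP]; rewrite -ltNge => xr; apply: hd; last exact/cball_box/sub2.
  have x0 : 0 < enorm x by exact: lt_trans xr.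
  rewrite -ball_normE /ball_ /= ger0_norm; last first.
    by rewrite subr_ge0 ler_pdivrMr// mul1r ltW.
  rewrite -(ltr_pM2r x0) mulrBl mul1r divfK ?gt_eqF// ltrBlDl.
  apply: (le_lt_trans xc); apply: (@lt_trans _ _ ((1 + d) * r)).
    by rewrite ltr_pM2r.
  by rewrite mulrDl mul1r ltrD2l ltr_pM2l.
have := shell_estimate c1 (fun x xc => hM x (sub2 x xc)) est.
rewrite (subrX1 c n); set p := \sum_(i < n) _ => H.
have k0 : 0 < c - 1 by rewrite subr_gt0.
rewrite -(ler_pM2l k0) -{1}(gtr0_norm k0) -normrM.
have -> : (c - 1) * (r ^+ 2 * (c + 1) * I - 2 * (p * J)) =
    r ^+ 2 * (c ^+ 2 - 1) * I - 2 * ((c - 1) * p * J) by ring.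
by apply: (le_trans H); rewrite le_eqVlt; apply/orP; left; apply/eqP; ring.
Unshelve. all: by end_near. Qed.

(** The two sides of [scaled_estimate] are a polynomial in c and the absolute value of one, so the
    limit is evaluation at 1. There the geometric sum is n and the term with [M] disappears. *)
Let limit_estimate e : 0 < e ->
  `|2 * (r ^+ 2 * I - n%:R * J)| <= e * (2 * (n%:R * m)).
Proof.
move=> e0; have r20 : 0 <= 2 * r by rewrite mulr_ge0// ltW.
have [M _ hM] := continuous_box_bounded r20 (smooth_continuous sD).
have est := scaled_estimate e0 (fun x xr => hM x (cball_box xr)).
pose q : {poly R} := \sum_(i < n) 'X^i.
have qE c : q.[c] = \sum_(i < n) c ^+ i.
  by rewrite horner_sum; apply: eq_bigr => i _; rewrite hornerXn.
pose L : {poly R} := (r ^+ 2)%:P * ('X + 1) * I%:P - 2%:P * (q * J%:P).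
pose U : {poly R} := ((r ^+ 2)%:P * ('X ^+ 2 - 1) * M%:P + (2 * e)%:P) * (q * m%:P).
have cL : (fun c => U.[c] - `|L.[c]|) @ (1 : R)^'+ --> U.[1] - `|L.[1]|.
  apply: cvg_at_right_filter; apply: cvgB; first exact: continuous_horner.
  by apply: cvg_norm; exact: continuous_horner.
have : 0 <= U.[1] - `|L.[1]|.
  apply: (cvgr_to_ge cL); apply: filterS est => c.
  rewrite subr_ge0 /L /U !(hornerD, hornerN, hornerM, hornerC, hornerX, hornerXn).
  by rewrite qE.
have q1 : q.[1] = n%:R.
  rewrite qE (eq_bigr (fun=> 1)) => [|i _]; last by rewrite expr1n.
  by rewrite sumr_const card_ord.
have -> : L.[1] = 2 * (r ^+ 2 * I - n%:R * J).
  by rewrite /L !(hornerD, hornerN, hornerM, hornerC, hornerX) q1; ring.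
have -> : U.[1] = e * (2 * (n%:R * m)).
  rewrite /U !(hornerD, hornerN, hornerM, hornerC, hornerX) q1.
  by ring.
by rewrite subr_ge0.
Qed.

Lemma radial_part_integrable :
  leb.-integrable (punctured_ball r) (EFin \o (fun x => a (radial_proj r x))).
Proof.
have [M hM] := b_bounded.
have Pb : punctured_ball r `<=` (box r : set 'rV[R]_n).
  by apply: subset_trans (@punctured_ball_cball _ _ _) _; exact: cball_box.
exact: (bounded_box_integrable (@measurable_punctured_ball R n r) (ltW r0) Pb
  (measurable_funTS mb) (fun x _ => hM x)).
Qed.

Lemma ball_divergence_cone : r ^+ 2 * I = n%:R * J.
Proof.
have m0 : 0 <= m by apply: Rintegral_ge0.
have K0 : 0 <= 2 * (n%:R * m) by rewrite !mulr_ge0.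
apply/eqP; rewrite -subr_eq0.
suff : 2 * (r ^+ 2 * I - n%:R * J) == 0 by rewrite mulf_eq0 pnatr_eq0.
rewrite -normr_eq0 eq_le normr_ge0 andbT; apply/ler_addgt0Pr => e e0.
(* Adding 1 makes the divisor positive without knowing that the volume is. *)
rewrite add0r; have k0 : 0 < 2 * (n%:R * m) + 1 by rewrite ltr_wpDl.
apply: (le_trans (limit_estimate (divr_gt0 e0 k0))).
by rewrite mulrAC ler_pdivrMr// ler_wpM2l ?ltW// ltrDl.
Qed.

End fixed_radius.

(** The factor 1 / r from normalising x and the factor n / r of the area measure combine to n / r^2,
    as [ball_divergence_cone] requires. *)
Lemma divergence_theorem_ball r : 0 < r ->
  \int[sphere_area r]_(x in sphere r) (\sum_i X i x * (x 0 i / enorm x))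
  = \int[leb]_(x in cball r) divX x.
Proof.
move=> r0; have sa := smooth_radial_part sX.
have sra : smooth (fun x => r^-1 * a x) by exact: smoothM (smooth_cst r^-1) sa.
rewrite (eq_Rintegral _ (g := fun x => r^-1 * a x)); last first.
  move=> x; rewrite inE /sphere /= => ->; rewrite /radial_part mulr_sumr.
  by apply: eq_bigr => i _; rewrite mulrA mulrC.
rewrite (Rintegral_sphere_area r0 (smooth_continuous sra)).
have mp := @measurable_punctured_ball R n r.
rewrite (RintegralZl _ mp); last exact: radial_part_integrable.
apply: (mulfI (lt0r_neq0 (exprn_gt0 2 r0))).
rewrite (ball_divergence_cone r0) mulrA mulrA; congr (_ * _).
by rewrite expr2; field; rewrite gt_eqF.
Qed.

End divergence_theorem.

(** * The Gauss-Bonnet-Chern mass *)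

Lemma Rintegral_cball_cvg (R : realType) (n : nat) (u : 'rV[R]_n -> R) :
  (lebesgue_rV R n).-integrable setT (EFin \o u) ->
  \int[lebesgue_rV R n]_(x in cball r) u x @[r --> +oo]
    --> \int[lebesgue_rV R n]_x u x.
Proof.
(* The limit is tested along sequences of radii, to which dominated convergence applies. *)
move=> iu; apply/cvg_pinftyP => v v_oo.
have mu : measurable_fun setT u by apply/measurable_EFinP; exact: measurable_int iu.
pose h k : 'rV[R]_n -> \bar R := (EFin \o u) \_ (cball (v k)).
have mh k : measurable_fun setT (h k).
  apply/(measurable_restrictT _ (@measurable_cball R n (v k))).
  by apply/measurable_funTS/measurable_EFinP.
have hE k : fine (\int[lebesgue_rV R n]_x h k x)%E =
    \int[lebesgue_rV R n]_(x in cball (v k)) u x.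
  by rewrite /h -integral_mkcond.
have hcvg : {ae lebesgue_rV R n, forall x, setT x ->
    h ^~ x @ \oo --> (EFin \o u) x}.
  apply: aeW => x _; apply: cvg_near_cst.
  (* Each point lies in the balls from some index on, where the truncations are constant. *)
  have : \forall k \near \oo, enorm x <= v k by move/cvgryPge : v_oo; exact.
  by apply: filterS => k xv; rewrite /h patchE mem_set.
have hdom : {ae lebesgue_rV R n, forall x k, setT x ->
    (`|h k x| <= (abse \o (EFin \o u)) x)%E}.
  apply: aeW => x k _; rewrite /h patchE; case: ifP => _ //.
  by rewrite abse0 abse_ge0.
have [_ _ icvg] := dominated_convergence measurableT mh (measurable_int _ iu) hcvg
  (integrable_abse iu) hdom.
rewrite (_ : (fun k => \int[lebesgue_rV R n]_(x in cball (v k)) u x) =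
    fine \o (fun k => \int[lebesgue_rV R n]_x h k x)%E); last first.
  by apply/funext => k /=; rewrite hE.
apply: fine_cvg; rewrite fineK//; exact: integrable_fin_num.
Qed.

Section graph_mass.
Context {R : realType} {n : nat}.
Variable f : 'rV[R]_n -> R.
Hypothesis sf : smooth f.
Local Notation g := (graph_metric f).
Local Notation L2 := (gauss_bonnet_L2 g).
Hypothesis iL2 : volume_integrable g L2.

Let sqrt_detE x : Num.sqrt (1 + enorm (grad f x) ^+ 2) = Num.sqrt (\det (g x)).
Proof. by rewrite enorm_grad det_graph_metric. Qed.

Let sqrt_det_ge1 x : 1 <= Num.sqrt (\det (g x)).
Proof.
by rewrite det_graph_metric -[X in X <= _]sqrtr1 ler_wsqrtr// lerDl slope2_ge0.
Qed.

Let divE x : divergence (gbc_field f) x = 2^-1 * L2 x.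
Proof. exact: div_gbc_field. Qed.

(** |L_2| is dominated by |L_2| sqrt (det g), and L_2 is measurable because it is twice the
    divergence of a smooth field. *)
Let iL2' : (lebesgue_rV R n).-integrable setT (EFin \o L2).
Proof.
apply: (le_integrable measurableT _ _ iL2) => [|x _].
  apply/measurable_EFinP.
  rewrite (_ : gauss_bonnet_L2 g = fun x => 2 * divergence (gbc_field f) x).
    apply: continuous_rV_measurable; apply: smooth_continuous.
    apply: smoothM (smooth_cst 2) _; apply: smooth_divergence.
    exact: smooth_gbc_field.
  by apply/funext => x; rewrite divE mulVKf ?pnatr_eq0.
rewrite /= lee_fin normrM ler_peMr// (le_trans (sqrt_det_ge1 x))//.
exact: ler_norm.
Qed.

Let ihalf : (lebesgue_rV R n).-integrable setT (EFin \o (fun x => 2^-1 * L2 x)).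
Proof. exact: (integrableZl measurableT 2^-1 iL2'). Qed.

Lemma gbc_flux_ball r : 0 < r ->
  gbc_flux g r = \int[lebesgue_rV R n]_(x in cball r) (2^-1 * L2 x).
Proof.
move=> r0; transitivity (\int[lebesgue_rV R n]_(x in cball r)
    divergence (gbc_field f) x); last by apply: eq_Rintegral => x _.
rewrite -(divergence_theorem_ball (smooth_gbc_field sf) r0).
apply: eq_Rintegral => x _; apply: eq_bigr => i _.
rewrite -gauss_bonnet_P_graph// mulr_suml; apply: eq_bigr => j _.
rewrite mulr_suml; apply: eq_bigr => k _.
by rewrite mulr_suml.
Qed.

Lemma gbc_flux_cvg :
  gbc_flux g r @[r --> +oo] --> 2^-1 * \int[lebesgue_rV R n]_x L2 x.
Proof.
rewrite -(RintegralZl _ measurableT iL2').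
apply: cvg_trans (Rintegral_cball_cvg ihalf).
apply: near_eq_cvg.
by apply: filterS (nbhs_pinfty_gt (num_real (0 : R))) => r /gbc_flux_ball ->.
Qed.

Lemma gbc_massE :
  gbc_mass g = gbc_c2 R n / 2 * \int[lebesgue_rV R n]_x L2 x.
Proof.
by rewrite /gbc_mass (cvg_lim _ gbc_flux_cvg)// mulrA.
Qed.

(** The denominator is the volume density sqrt (det g), so the two cancel. *)
Lemma volume_integral_graph :
  volume_integral g
    (fun x => L2 x / Num.sqrt (1 + enorm (grad f x) ^+ 2))
  = \int[lebesgue_rV R n]_x L2 x.
Proof.
apply: eq_Rintegral => x _; rewrite sqrt_detE divfK// gt_eqF//.
exact: lt_le_trans (sqrt_det_ge1 x).
Qed.

End graph_mass.

Lemma gbc_c2_ge0 (R : realType) (n : nat) : (3 <= n)%N -> 0 <= gbc_c2 R n.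
Proof.
move=> n3; have nk k : (k <= 3)%N -> 0 <= n%:R - k%:R :> R.
  by move=> k3; rewrite subr_ge0 ler_nat (leq_trans k3).
rewrite invr_ge0; apply: mulr_ge0; last exact/fine_ge0/measure_ge0.
by rewrite !mulr_ge0//; [exact: nk 1%N isT|exact: nk 2%N isT|exact: nk 3%N isT].
Qed.

Theorem theorem1p4 (R : realType) (n : nat) (f : 'rV[R]_n -> R) (tau : R) :
  (5 <= n)%N ->
  smooth f ->
  (n%:R - 4) / 3 < tau ->
  asymptotically_flat tau f ->
  let g := graph_metric f in
  volume_integrable g (gauss_bonnet_L2 g) ->
  [/\ cvg (gbc_flux g r @[r --> +oo]),
      gbc_mass g = gbc_c2 R n / 2 *
        volume_integral g
          (fun x => gauss_bonnet_L2 g x / Num.sqrt (1 + enorm (grad f x) ^+ 2))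
    & (forall x, 0 <= gauss_bonnet_L2 g x) -> 0 <= gbc_mass g].
Proof.
move=> n5 sf _ _ g iL2.
have massE := gbc_massE sf iL2; split.
- by apply/cvg_ex; eexists; exact: gbc_flux_cvg sf iL2.
- by rewrite massE volume_integral_graph.
- move=> L2_ge0; rewrite massE; apply: mulr_ge0; last exact: Rintegral_ge0.
  by apply: divr_ge0 => //; apply: gbc_c2_ge0; exact: leq_trans n5.
Qed.
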